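(* Let $\Omega\subset\mathbb R^m$, $m\ge2$, be a bounded connected Lipschitz domain, let $(e_j)_{j\in\mathbb N}$ be an orthonormal basis of $L^2_\diamond(\partial\Omega)$, and let $H_N=\operatorname{span}\{e_1,\dots,e_N\}$. Let $\mathcal M\subset L^\infty(\Omega)$ be a second-countable embedded real-analytic manifold of dimension $d$, and let $K\subset L^\infty_+(\Omega)\cap\mathcal M$ be compact. With $\Lambda_\sigma$ the Neumann-to-Dirichlet map, assume that: (i) $\sigma\mapsto\Lambda_\sigma$ is injective on $K$; (ii) for every $\sigma\in K$, the differential $d\Lambda_\sigma\colon T_\sigma\mathcal M\to\mathcal K(L^2_\diamond(\partial\Omega))$ is injective. Then there exists $N_0\in\mathbb N$ such that for every $N\ge N_0$ the following holds. Let $\rho_N$ be a probability measure on $H_N$ that is absolutely continuous with respect to Lebesgue measure, let $M\ge2d+1$, and let $(f_1,g_1),\dots,(f_M,g_M)\in H_N\times H_N$ be independent samples with law $\rho_N\otimes\rho_N$. Then, with probability one, for every $\sigma_1,\sigma_2\in K$: if $\langle\Lambda_{\sigma_1}f_i,g_i\rangle_{L^2(\partial\Omega)}=\langle\Lambda_{\sigma_2}f_i,g_i\rangle_{L^2(\partial\Omega)}$ for $i=1,\dots,M$, then $\sigma_1=\sigma_2$.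
   Context: All function spaces are real. $L^\infty_+(\Omega)=\{\sigma\in L^\infty(\Omega):\operatorname{ess\,inf}_\Omega\sigma>0\}$ and $L^2_\diamond(\partial\Omega)=\{f\in L^2(\partial\Omega):\int_{\partial\Omega}f\,ds=0\}$. For $\sigma\in L^\infty_+(\Omega)$ and $f\in L^2_\diamond(\partial\Omega)$, $u_{\sigma,f}\in H^1(\Omega)$ is the weak solution, normalized by $\int_{\partial\Omega}u_{\sigma,f}\,ds=0$, of $-\nabla\cdot(\sigma\nabla u)=0$ in $\Omega$, $\sigma\partial_\nu u=f$ on $\partial\Omega$ (i.e. $\int_\Omega\sigma\nabla u\cdot\nabla v\,dx=\int_{\partial\Omega}f\,v|_{\partial\Omega}\,ds$ for all $v\in H^1(\Omega)$). The Neumann-to-Dirichlet map is $\Lambda_\sigma\colon L^2_\diamond(\partial\Omega)\to L^2_\diamond(\partial\Omega)$, $\Lambda_\sigma f=u_{\sigma,f}|_{\partial\Omega}$. $\mathcal K(L^2_\diamond(\partial\Omega))$ is the space of compact operators from $L^2_\diamond(\partial\Omega)$ to itself, with the operator norm. $d\Lambda_\sigma$ denotes the Fréchet differential at $\sigma$ of $\Lambda\colon L^\infty_+(\Omega)\to\mathcal K(L^2_\diamond(\partial\Omega))$, $\sigma\mapsto\Lambda_\sigma$, here restricted to $T_\sigma\mathcal M\subset L^\infty(\Omega)$. Real analytic map: for real Banach spaces $Y_1,Y_2$ and $U\subset Y_1$ open, $G\colon U\to Y_2$ is real analytic if for every $y\in U$ there are $\rho>0$ and continuous symmetric $j$-linear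 maps $G_j\colon Y_1^j\to Y_2$, $j\ge0$, with $\sum_{j\ge0}\|G_j\|\rho^j<\infty$ and $G(y+h)=\sum_{j\ge0}G_j(h,\dots,h)$ for $\|h\|_{Y_1}<\rho$. Embedded real-analytic manifold of dimension $d$ in a Banach space $X$: a subset $\mathcal M\subset X$ (with the topology induced by $X$) such that for every $a\in\mathcal M$ there are an open set $V\subset\mathbb R^d$ and a real-analytic map (chart) $\varphi\colon V\to X$ such that $d\varphi_t$ is injective for every $t\in V$ and $\varphi$ is a homeomorphism from $V$ onto an open neighbourhood of $a$ in $\mathcal M$. The tangent space is $T_a\mathcal M=d\varphi_{\varphi^{-1}(a)}(\mathbb R^d)\subset X$. *)

(* Defs.v *)
From HB Require Import structures.
From mathcomp Require Import all_boot all_order all_algebra perm.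
From mathcomp Require Import all_classical all_reals all_analysis.
From mathcomp Require Import measurable_realfun ess_sup_inf.
Set Implicit Arguments.
Unset Strict Implicit.
Unset Printing Implicit Defensive.
Import Order.TTheory GRing.Theory Num.Def Num.Theory.
Import numFieldNormedType.Exports.
Local Open Scope classical_set_scope.
Local Open Scope ring_scope.

Section Lp_space.
Context d (T : measurableType d) (R : realType).
Variables (mu : {measure set T -> \bar R}) (p : \bar R) (p1 : (1 <= p)%E).
Local Open Scope quotient_scope.

Definition ae_null : {pred LfunType mu p1} :=
  [pred f : LfunType mu p1 | `[< (f : T -> R) = cst 0 %[ae mu] >]].

Lemma ae_null_zmod_closed : zmod_closed ae_null.
Proof.
split=> [|f g]; rewrite !inE.
  by apply: nearW.
move=> f0 g0; near=> x => _.
have -> : (f - g : LfunType mu p1) x = f x - g x by [].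
have -> : f x = 0 by move: (I); near: x.
have -> : g x = 0 by move: (I); near: x.
by rewrite subrr.
Unshelve. all: by end_near. Qed.

HB.instance Definition _ :=
  GRing.isZmodClosed.Build (LfunType mu p1) ae_null ae_null_zmod_closed.

(* L^p(mu) as a normed space: p-integrable measurable functions (essentially
   bounded ones for p = +oo) modulo almost everywhere equality *)
Definition Lp : Type := Quotient.quot ae_null.
HB.instance Definition _ := GRing.Zmodule.on Lp.
HB.instance Definition _ := EqQuotient.on Lp.

Definition Lp_fun (f : Lp) : T -> R := (repr f : LfunType mu p1).
Coercion Lp_fun : Lp >-> Funclass.

Lemma Lp_piP (f g : LfunType mu p1) :
  (\pi_Lp f = \pi_Lp g) <-> (f : T -> R) = g %[ae mu].
Proof.
split=> [/eqP|fg].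
  rewrite /Lp -Quotient.idealrBE inE => fg.
  near=> x => _; apply/eqP; rewrite -subr_eq0; apply/eqP.
  by move: (I); near: x.
apply/eqP; rewrite /Lp -Quotient.idealrBE inE.
near=> x => _.
have -> : (f - g : LfunType mu p1) x = f x - g x by [].
have -> : f x = g x by move: (I); near: x.
by rewrite subrr.
Unshelve. all: by end_near. Qed.

Lemma Lp_reprK (f : LfunType mu p1) :
  ((repr (\pi_Lp f) : LfunType mu p1) : T -> R) = f %[ae mu].
Proof. by apply/Lp_piP; rewrite reprK. Qed.

Definition Lp_scale (a : R) (f : Lp) : Lp :=
  \pi_Lp (a *: (repr f : LfunType mu p1)).

Lemma pi_scale a (f : LfunType mu p1) : \pi_Lp (a *: f) = Lp_scale a (\pi_Lp f).
Proof.
apply/Lp_piP; near=> x => _.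
rewrite -[LHS]/(a * f x) -[RHS]/(a * (repr (\pi_Lp f) : LfunType mu p1) x).
congr (_ * _); apply/esym; move: (I); near: x; exact: Lp_reprK.
Unshelve. all: by end_near. Qed.

Lemma pi_add (f g : LfunType mu p1) : \pi_Lp (f + g) = \pi_Lp f + \pi_Lp g.
Proof. by rewrite /Lp !piE. Qed.

Let scaleA a b f : Lp_scale a (Lp_scale b f) = Lp_scale (a * b) f.
Proof.
rewrite -[f]reprK; move: (repr f) => g.
by rewrite -[Lp_scale b _]pi_scale -2!pi_scale scalerA.
Qed.

Let scale1 : left_id 1 Lp_scale.
Proof.
move=> f; rewrite -[f]reprK; move: (repr f) => g.
by rewrite -pi_scale scale1r.
Qed.

Let scaleDr : right_distributive Lp_scale +%R.
Proof.
move=> a f g; rewrite -[f]reprK -[g]reprK.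
move: (repr f) (repr g) => {}f {}g.
by rewrite -pi_add -3!pi_scale scalerDr pi_add.
Qed.

Let scaleDl f : {morph Lp_scale^~ f : a b / a + b}.
Proof.
move=> a b /=; rewrite -[f]reprK; move: (repr f) => {}f.
by rewrite -3!pi_scale scalerDl pi_add.
Qed.

HB.instance Definition _ :=
  GRing.Zmodule_isLmodule.Build R Lp scaleA scale1 scaleDr scaleDl.

Definition Lp_norm (f : Lp) : R := fine ('N[mu]_p [EFin \o f])%E.

Lemma ae_eq_Lnorm (f g : T -> R) : measurable_fun setT f ->
  measurable_fun setT g -> f = g %[ae mu] ->
  ('N[mu]_p [EFin \o f] = 'N[mu]_p [EFin \o g])%E.
Proof.
move=> mf mg fg; rewrite unlock /Lnorm; case: p p1 => [r r1| |//].
- congr (_ `^ _)%E; apply: ge0_ae_eq_integral => //.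
  + by apply/measurable_EFinP/(measurableT_comp (measurable_powR _))/measurableT_comp.
  + by apply/measurable_EFinP/(measurableT_comp (measurable_powR _))/measurableT_comp.
  + by move=> x _; exact: poweR_ge0.
  + by move=> x _; exact: poweR_ge0.
  + by apply: filterS fg => x fgx _ /=; rewrite fgx.
- move=> _; case: ifPn => // _; apply: eq_ess_sup.
  by apply: filterS fg => x fgx /=; rewrite fgx.
Qed.

Lemma Lp_norm_pi (f : LfunType mu p1) :
  Lp_norm (\pi_Lp f) = fine ('N[mu]_p [EFin \o f])%E.
Proof. by congr fine; apply: ae_eq_Lnorm => //; exact: Lp_reprK. Qed.

Let ler_Lp_normD f g : Lp_norm (f + g) <= Lp_norm f + Lp_norm g.
Proof.
rewrite -[f]reprK -[g]reprK -pi_add !Lp_norm_pi.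
exact: (ler_LnormD (repr f : LfunType mu p1) (repr g)).
Qed.

Let Lp_normZ a f : Lp_norm (a *: f) = `|a| * Lp_norm f.
Proof.
rewrite -[f]reprK; move: (repr f) => {}f.
rewrite (_ : a *: \pi_Lp f = \pi_Lp (a *: f)); last by rewrite pi_scale.
rewrite !Lp_norm_pi.
rewrite -[in RHS]/(fine `|a|%:E) -fineM//; last by rewrite -finite_norm_fine.
by congr fine; exact: LnormZ.
Qed.

Let Lp_norm_eq0 f : Lp_norm f = 0 -> f = 0.
Proof.
rewrite -[f]reprK Lp_norm_pi => /fine_Lnormr_eq0 f0.
have -> : (0 : Lp) = \pi_Lp (0 : LfunType mu p1) by rewrite /Lp piE.
exact/Lp_piP.
Qed.

HB.instance Definition _ :=
  Lmodule_isNormed.Build R Lp ler_Lp_normD Lp_normZ Lp_norm_eq0.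

End Lp_space.
Arguments Lp {d T R} mu {p} p1.

Section L2_mean_zero.
Context d (T : measurableType d) (R : realType).
Variable mu : {measure set T -> \bar R}.

Local Open Scope quotient_scope.
Local Notation L2 := (Lp mu (lee1n 2)).

(* the integrability conjunct is automatic when mu is finite *)
Definition mean_zero : {pred L2} :=
  [pred f : L2 | `[< mu.-integrable setT (EFin \o f) /\ \int[mu]_x f x = 0 >]].

Lemma Lp_funZD (a : R) (f g : L2) :
  ((a *: f + g : L2) : T -> R) = (fun x => a * f x + g x) %[ae mu].
Proof.
rewrite -[f]reprK -[g]reprK; move: (repr f) (repr g) => {}f {}g.
rewrite (_ : a *: _ = \pi_(Lp mu (lee1n 2)) (a *: f)); last by rewrite pi_scale.
rewrite -pi_add.
apply: filter_app (Lp_reprK (a *: f + g)).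
apply: filter_app (Lp_reprK f).
apply: filterS (Lp_reprK g) => x gx fx fgx _.
rewrite /Lp_fun fx// gx// fgx//.
Qed.

Lemma ae_mean_zero (f g : T -> R) : measurable_fun setT f ->
  measurable_fun setT g -> f = g %[ae mu] ->
  mu.-integrable setT (EFin \o f) -> \int[mu]_x f x = 0 ->
  mu.-integrable setT (EFin \o g) /\ \int[mu]_x g x = 0.
Proof.
move=> mf mg fg intf f0.
have fgE : ae_eq mu setT (EFin \o f) (EFin \o g).
  by apply: filterS fg => x fgx _ /=; rewrite fgx.
split.
  apply/integrableP; split; first exact/measurable_EFinP.
  rewrite -(@ge0_ae_eq_integral _ _ _ mu _ (abse \o (EFin \o f)))//.
  - by case/integrableP : intf.
  - exact/measurableT_comp/measurable_EFinP.
  - exact/measurableT_comp/measurable_EFinP.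
  - by move=> x _; exact: abse_ge0.
  - by apply: filterS fg => x fgx _ /=; rewrite fgx.
rewrite -f0 /Rintegral; congr fine; apply/esym/ae_eq_integral => //.
- exact/measurable_EFinP.
- exact/measurable_EFinP.
Qed.

Lemma mean_zero_submod_closed : submod_closed mean_zero.
Proof.
split.
  have -> : (0 : L2) = \pi_(Lp mu (lee1n 2)) 0 by rewrite /Lp piE.
  rewrite inE; apply: (@ae_mean_zero (cst 0)) => //.
  - by apply: filterS (@Lp_reprK _ _ _ mu _ (lee1n 2) 0) => x h _; rewrite /Lp_fun h.
  - exact: integrable0.
  - by rewrite /Rintegral integral0.
suff h (a : R) (f g : L2) : f \in mean_zero -> g \in mean_zero ->
    a *: f + g \in mean_zero by exact: h.
rewrite !inE => -[intf f0] [intg g0].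
apply: (@ae_mean_zero (fun x => a * f x + g x)) => //.
- by apply: measurable_funD => //; exact: measurable_funM.
- by apply: filterS (Lp_funZD a f g) => x h _; rewrite h.
- rewrite (_ : _ \o _ = (fun x => a%:E * (EFin \o f) x) \+ (EFin \o g))%E//.
  by apply: integrableD => //; exact: integrableZl.
- rewrite RintegralD//; last exact: (integrableZl measurableT a intf).
  by rewrite RintegralZl// f0 g0 mulr0 addr0.
Qed.

HB.instance Definition _ :=
  GRing.isSubmodClosed.Build R L2 mean_zero mean_zero_submod_closed.

Record L2mean0 := MkL2mean0 { L2val :> L2; L2valP : L2val \in mean_zero }.
HB.instance Definition _ := [isSub for L2val].
HB.instance Definition _ := [Choice of L2mean0 by <:].
HB.instance Definition _ := [SubChoice_isSubLmodule of L2mean0 by <:].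

Let ler_normD (f g : L2mean0) : `|L2val (f + g)| <= `|L2val f| + `|L2val g|.
Proof. exact: (Num.Theory.ler_normD (L2val f) (L2val g)). Qed.
Let normZ a (f : L2mean0) : `|L2val (a *: f)| = `|a| * `|L2val f|.
Proof. exact: (normrZ a (L2val f)). Qed.
Let norm_eq0 (f : L2mean0) : `|L2val f| = 0 -> f = 0.
Proof. by move=> /normr0_eq0 f0; apply: val_inj; rewrite /= f0. Qed.

HB.instance Definition _ :=
  Lmodule_isNormed.Build R L2mean0 ler_normD normZ norm_eq0.

Definition L2_inner (f g : L2) : R := \int[mu]_x (f x * g x).

End L2_mean_zero.


Section compact_operators.
Context (R : realType) (V W : normedModType R).

(* linear maps sending the unit ball to a relatively compact set, normed by
   the operator norm *)
Definition is_compact_op : {pred V -> W} := [pred f : V -> W |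
  `[< linear f /\ precompact (f @` [set x | `|x| <= 1]) >]].

Lemma is_compact_op_submod_closed : submod_closed is_compact_op.
Proof.
split.
  rewrite inE; split; first by move=> a x y; rewrite scaler0 addr0.
  apply: (@precompact_subset _ _ [set 0]); first by move=> _ [x _ <-].
  exact: (compact_precompact (@norm_hausdorff _ _) (@compact_set1 _ _)).
move=> a f g; rewrite !inE => -[lf cf] [lg cg]; split.
  move=> b x y; rewrite !fctE lf lg !scalerDr !scalerA mulrC.
  by rewrite -!addrA; congr (_ + _); rewrite addrCA.
move: cf cg; rewrite !precompactE => cf cg.
pose h (p : W * W) := a *: p.1 + p.2.
have ch : continuous h.
  move=> p; apply: cvgD; last exact: cvg_snd.
  by apply: cvgZ; [exact: cvg_cst|exact: cvg_fst].
have := continuous_compact (continuous_subspaceT ch) (compact_setX cf cg).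
move=> /(compact_precompact (@norm_hausdorff _ _)).
rewrite -precompactE; apply: precompact_subset => _ [x x1 <-].
by exists (f x, g x) => //; split; apply: subset_closure; exists x.
Qed.

HB.instance Definition _ :=
  GRing.isSubmodClosed.Build R (V -> W) is_compact_op is_compact_op_submod_closed.

Record compact_op := MkCompactOp {
  compact_op_fun :> V -> W;
  compact_opP : compact_op_fun \in is_compact_op }.
HB.instance Definition _ := [isSub for compact_op_fun].
HB.instance Definition _ := [Choice of compact_op by <:].
HB.instance Definition _ := [SubChoice_isSubLmodule of compact_op by <:].

Definition op_norm (f : compact_op) : R := sup [set `|f x| | x in [set x | `|x| <= 1]].

Lemma op_norm_has_sup (f : compact_op) :
  has_sup [set `|f x| | x in [set x | `|x| <= 1]].
Proof.
have := compact_opP f; rewrite inE precompactE => -[_ /compact_bounded].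
rewrite /bounded_set/= => -[M [_ fM]].
split; first by exists `|f 0|, 0 => //=; rewrite normr0.
exists (M + 1) => _ [x x1 <-]; apply: fM; first by rewrite ltrDl.
by apply: subset_closure; exists x.
Qed.

Lemma op_norm_le (f : compact_op) M : (forall x, `|x| <= 1 -> `|f x| <= M) ->
  op_norm f <= M.
Proof.
move=> fM; apply: ge_sup; first by have [] := op_norm_has_sup f.
by move=> _ [x /= x1 <-]; exact: fM.
Qed.

Lemma op_norm_ub (f : compact_op) x : `|x| <= 1 -> `|f x| <= op_norm f.
Proof.
move=> x1; apply: ub_le_sup; last by exists x.
by have [] := op_norm_has_sup f.
Qed.

Let ler_op_normD (f g : compact_op) : op_norm (f + g) <= op_norm f + op_norm g.
Proof.
apply: op_norm_le => x x1; rewrite -[(f + g) x]/(f x + g x).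
by rewrite (le_trans (ler_normD _ _))// lerD// op_norm_ub.
Qed.

Let op_normZ_le a (f : compact_op) : op_norm (a *: f) <= `|a| * op_norm f.
Proof.
apply: op_norm_le => x x1; rewrite -[(a *: f) x]/(a *: f x) normrZ.
by rewrite ler_wpM2l// op_norm_ub.
Qed.

Let op_normZ a (f : compact_op) : op_norm (a *: f) = `|a| * op_norm f.
Proof.
apply/eqP; rewrite eq_le op_normZ_le/=.
have [->|a0] := eqVneq a 0.
  rewrite normr0 mul0r scale0r (le_trans _ (op_norm_ub 0 (_ : `|0| <= 1)))//.
  by rewrite normr0.
rewrite -ler_pdivlMl ?normr_gt0// -normfV.
by rewrite (le_trans _ (op_normZ_le _ _))// scalerA mulVf// scale1r.
Qed.

Let op_norm_eq0 (f : compact_op) : op_norm f = 0 -> f = 0.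
Proof.
move=> f0; apply/val_inj/funext => x /=.
have lf : linear f by have := compact_opP f; rewrite inE => -[].
have fZ a y : f (a *: y) = a *: f y.
  have f00 : f 0 = 0.
    by have := lf 1 0 0; rewrite !scale1r addr0 => /eqP; rewrite eq_sym -subr_eq0 addrK => /eqP.
  by rewrite -[a *: y]addr0 lf f00 addr0.
have [->|x0] := eqVneq x 0.
  by rewrite -(scale0r 0) fZ scale0r.
have := op_norm_ub f (_ : `| `|x|^-1 *: x| <= 1).
rewrite f0 normrZ normfV normr_id mulVf ?normr_eq0// => /(_ (lexx _)).
rewrite normr_le0 fZ scaler_eq0 invr_eq0 normr_eq0 (negbTE x0)/=.
by move=> /eqP.
Qed.

HB.instance Definition _ :=
  Lmodule_isNormed.Build R compact_op ler_op_normD op_normZ op_norm_eq0.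

End compact_operators.

Section outer_measures.
Local Open Scope ereal_scope.
Context (R : realType) (T : pointedType).

Section cover.
Variable w : set T -> \bar R.
Hypotheses (w0 : w set0 = 0) (w_ge0 : forall A, 0 <= w A).

(* no measurability is required of the covering sets, unlike in mu_ext *)
Definition cover_ext (A : set T) : \bar R := ereal_inf
  [set \sum_(k <oo) w (C k) | C in [set C : (set T)^nat | A `<=` \bigcup_k C k]].

Let S := g_sigma_algebraType [set: set T].

Lemma cover_extE : cover_ext = @mu_ext _ S R w.
Proof.
apply/funext => A; congr ereal_inf; apply/seteqP; split => _ [C CA <-].
  by exists C => //; split => // i; exact: sub_sigma_algebra.
by exists C => //; case: CA.
Qed.

Lemma cover_ext0 : cover_ext set0 = 0.
Proof. by rewrite cover_extE; exact: (@mu_ext0 _ S). Qed.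
Lemma cover_ext_ge0 A : 0 <= cover_ext A.
Proof. by rewrite cover_extE; exact: (@mu_ext_ge0 _ S). Qed.
Lemma le_cover_ext : {homo cover_ext : A B / A `<=` B >-> A <= B}.
Proof. by rewrite cover_extE; exact: (@le_mu_ext _ S). Qed.
Lemma cover_ext_sigma_subadditive : sigma_subadditive cover_ext.
Proof. by rewrite cover_extE; exact: (@mu_ext_sigma_subadditive _ S). Qed.
End cover.

Section restriction.
Variables (mu : {outer_measure set T -> \bar R}) (D : set T).

(* The restriction of mu to D, as an outer measure: its Caratheodory measurable
   sets are the A such that A `&` D splits every subset of D. *)
Definition outer_restr (A : set T) : \bar R := mu (A `&` D).

Let outer_restr0 : outer_restr set0 = 0.
Proof. by rewrite /outer_restr set0I outer_measure0. Qed.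
Let outer_restr_ge0 A : 0 <= outer_restr A.
Proof. exact: outer_measure_ge0. Qed.
Let le_outer_restr : {homo outer_restr : A B / A `<=` B >-> A <= B}.
Proof. by move=> A B AB; apply: le_outer_measure; exact: setSI. Qed.
Let outer_restr_sigma_subadditive : sigma_subadditive outer_restr.
Proof.
by move=> F; rewrite /outer_restr setI_bigcupl; exact: outer_measure_sigma_subadditive.
Qed.

HB.instance Definition _ := isOuterMeasure.Build R T outer_restr
  outer_restr0 outer_restr_ge0 le_outer_restr outer_restr_sigma_subadditive.
End restriction.

End outer_measures.

Section euclidean.
Context {R : realType} {n : nat}.

Definition dotp (x y : 'rV[R]_n) : R := \sum_(i < n) x ord0 i * y ord0 i.
(* the norm of the library on 'rV[R]_n is the sup norm *)
Definition enorm (x : 'rV[R]_n) : R := Num.sqrt (dotp x x).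
Definition diam (A : set 'rV[R]_n) : R := sup [set enorm (x - y) | x in A & y in A].

End euclidean.


Definition rV_display : measure_display. Proof. exact: (default_measure_display). Qed.

Section measurable_rV.
Context {R : realType} (n : nat).
(* Borel sigma-algebra of R^n, generated by the coordinates *)
Let coord (i : 'I_n) (x : 'rV[R]_n) : measurableTypeR R := x ord0 i.
Let S : set (set 'rV[R]_n) := g_sigma_preimage coord.

Let rV_set0 : S set0. Proof. exact: sigma_algebra0. Qed.
Let rV_setC A : S A -> S (~` A). Proof. exact: sigma_algebraC. Qed.
Let rV_bigcup (F : _^nat) : (forall i, S (F i)) -> S (\bigcup_i (F i)).
Proof. exact: sigma_algebra_bigcup. Qed.

HB.instance Definition _ :=
  @isMeasurable.Build rV_display 'rV[R]_n S rV_set0 rV_setC rV_bigcup.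

Lemma measurable_coord (i : 'I_n) :
  measurable_fun [set: 'rV[R]_n] (fun x : 'rV[R]_n => x ord0 i).
Proof.
move=> _ Y mY; rewrite setTI; apply: sub_sigma_algebra => /=.
rewrite -bigcup_seq/=; exists i => /=; first by rewrite mem_index_enum.
by exists Y => //; rewrite setTI.
Qed.

Lemma measurable_fun_rV d (T : measurableType d) (f : T -> 'rV[R]_n) :
  (forall i, measurable_fun setT (fun x => f x ord0 i)) -> measurable_fun setT f.
Proof.
move=> mf; apply: (@measurability _ _ _ _ _ _
  (\big[setU/set0]_(i < n) preimage_set_system setT (coord i) measurable)) => //.
move=> _ [B + <-]; rewrite -bigcup_seq => -[i _ [C mC <-]].
by rewrite !setTI -[X in measurable X]setTI; exact: (mf i measurableT C mC).
Qed.

End measurable_rV.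

Section lebesgue_rV.
Context {R : realType}.

Definition rV_cons n (p : measurableTypeR R * 'rV[R]_n) : 'rV[R]_n.+1 :=
  \row_i oapp (p.2 ord0) p.1 (unlift ord0 i).

Definition rV_uncons n (x : 'rV[R]_n.+1) : measurableTypeR R * 'rV[R]_n :=
  (x ord0 ord0, \row_i x ord0 (lift ord0 i)).

Lemma rV_consK n : cancel (@rV_cons n) (@rV_uncons n).
Proof.
move=> [a x]; rewrite /rV_uncons mxE unlift_none/=; congr pair.
by apply/rowP => i; rewrite !mxE liftK.
Qed.

Lemma rV_unconsK n : cancel (@rV_uncons n) (@rV_cons n).
Proof.
move=> x; apply/rowP => i; rewrite mxE.
by case: unliftP => [j|] -> //=; rewrite mxE.
Qed.

Lemma measurable_rV_cons n : measurable_fun setT (@rV_cons n).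
Proof.
apply: measurable_fun_rV => i.
case: (unliftP ord0 i) => [j ij|i0].
  rewrite (_ : (fun _ => _) = (fun x : 'rV[R]_n => x ord0 j) \o snd).
    exact: (measurableT_comp (measurable_coord j)).
  by apply/funext => -[a x] /=; rewrite mxE ij liftK.
rewrite (_ : (fun _ => _) = fst)//.
by apply/funext => -[a x] /=; rewrite mxE i0 unlift_none.
Qed.

Lemma measurable_rV_uncons n : measurable_fun setT (@rV_uncons n).
Proof.
apply/measurable_fun_pairP; split; first exact: measurable_coord.
apply: measurable_fun_rV => i.
rewrite (_ : (fun _ => _) = (fun x : 'rV[R]_n.+1 => x ord0 (lift ord0 i))).
  exact: measurable_coord.
by apply/funext => x; rewrite /= mxE.
Qed.

Section step.

Lemma sigma_finite_product d1 d2 (T1 : measurableType d1)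
    (T2 : measurableType d2) (m1 : {sigma_finite_measure set T1 -> \bar R})
    (m2 : {sigma_finite_measure set T2 -> \bar R}) :
  sigma_finite setT (m1 \x m2)%E.
Proof.
have /sigma_finiteP[F [TF ndF Foo]] := sigma_finiteT m1.
have /sigma_finiteP[G [TG ndG Goo]] := sigma_finiteT m2.
exists (fun k => F k `*` G k).
  rewrite -setXTT TF TG predeqE => -[x y]; split.
    move=> [/= [k _ Fkx] [l _ Gly]]; exists (maxn k l) => //; split.
    - by move: x Fkx; exact/subsetPset/ndF/leq_maxl.
    - by move: y Gly; exact/subsetPset/ndG/leq_maxr.
  by move=> [k _ []/= ? ?]; split; exists k.
move=> k; have [? ?] := Foo k; have [? ?] := Goo k.
split; first exact: measurableX.
by rewrite product_measure1E// lte_mul_pinfty// ge0_fin_numE.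
Qed.

Variables (n : nat) (mu : {sigma_finite_measure set 'rV[R]_n -> \bar R}).

Definition lebesgue_rV_step : set 'rV[R]_n.+1 -> \bar R :=
  pushforward (@lebesgue_measure R \x mu)%E (@rV_cons n).

Let preimage_measurable A : measurable A -> measurable (@rV_cons n @^-1` A).
Proof. by move=> mA; rewrite -[X in measurable X]setTI; exact: measurable_rV_cons. Qed.

Let step0 : lebesgue_rV_step set0 = 0%E.
Proof. by rewrite /lebesgue_rV_step /pushforward preimage_set0 measure0. Qed.

Let step_ge0 A : (0 <= lebesgue_rV_step A)%E.
Proof. by rewrite /lebesgue_rV_step /pushforward. Qed.

Let step_sigma_additive : semi_sigma_additive lebesgue_rV_step.
Proof.
move=> F mF tF mUF; rewrite /lebesgue_rV_step /pushforward preimage_bigcup.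
apply: measure_semi_sigma_additive => //.
- by move=> k; exact: preimage_measurable.
- apply/trivIsetP => i j _ _ ij; rewrite -preimage_setI.
  by move/trivIsetP : tF => /(_ _ _ _ _ ij) ->//; rewrite preimage_set0.
- by rewrite -preimage_bigcup; exact: preimage_measurable.
Qed.

HB.instance Definition _ :=
  isMeasure.Build _ _ _ lebesgue_rV_step step0 step_ge0 step_sigma_additive.

Let sigma_finite_step : sigma_finite setT lebesgue_rV_step.
Proof.
have [F FT Foo] := sigma_finite_product (@lebesgue_measure R) mu.
exists (fun k => @rV_uncons n @^-1` F k).
  by rewrite -preimage_bigcup -FT preimage_setT.
move=> k; have [mF Fk] := Foo k; split.
  by rewrite -[X in measurable X]setTI; exact: measurable_rV_uncons.
rewrite /lebesgue_rV_step /pushforward -comp_preimage.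
by rewrite (_ : _ \o _ = id) ?preimage_id//; apply/funext => x; exact: rV_consK.
Qed.

HB.instance Definition _ :=
  Measure_isSigmaFinite.Build _ _ _ lebesgue_rV_step sigma_finite_step.
End step.

Fixpoint lebesgue_rV (n : nat) : {sigma_finite_measure set 'rV[R]_n -> \bar R} :=
  if n is n'.+1 then lebesgue_rV_step (lebesgue_rV n') else \d_(0 : 'rV[R]_0).

End lebesgue_rV.

Section caratheodory.
Context (R : realType) (T : pointedType).
Definition cara_measure (mu : {outer_measure set T -> \bar R}) :
    {measure set (caratheodory_type mu) -> \bar R} :=
  [the {measure set (caratheodory_type mu) -> \bar R} of
    (mu : set (caratheodory_type mu) -> \bar R)].
End caratheodory.

Section hausdorff.
Context {R : realType} {n : nat}.
Implicit Types (s : nat) (A C : set 'rV[R]_n).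
Local Open Scope ereal_scope.

Definition unit_ball_volume s : R :=
  fine (lebesgue_rV s [set x : 'rV[R]_s | (enorm x <= 1)%R]).

(* Normalized so that the s-dimensional measure is the surface measure of
   s-dimensional Lipschitz graphs. [diam C] is meaningful on the first branch,
   where C is bounded. *)
Definition hausdorff_gauge s (delta : R) C : \bar R :=
  if `[< forall x y, C x -> C y -> (enorm (x - y)%R <= delta)%R >]
  then ((C != set0)%:R * (unit_ball_volume s * (diam C / 2) ^+ s)%R)%:E
  else +oo.

Definition hausdorff s A : \bar R :=
  ereal_sup [set cover_ext (hausdorff_gauge s delta) A |
              delta in [set delta : R | (0 < delta)%R]].

Lemma enorm_ge0 k (x : 'rV[R]_k) : (0 <= enorm x)%R.
Proof. exact: sqrtr_ge0. Qed.

Lemma diam_ge0 C : (0 <= diam C)%R.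
Proof.
have [hs|nhs] := pselect (has_sup [set enorm (x - y)%R | x in C & y in C]).
  have [[r [x Cx [y Cy _]]] hub] := hs.
  apply: (le_trans (enorm_ge0 (x - y)%R)); apply: ub_le_sup => //.
  by exists x => //; exists y.
by rewrite /diam sup_out.
Qed.

Lemma hausdorff_gauge0 s delta : hausdorff_gauge s delta set0 = 0.
Proof.
rewrite /hausdorff_gauge eqxx mul0r; case: asboolP => // -[].
by move=> x y [].
Qed.

Lemma hausdorff_gauge_ge0 s delta C : 0 <= hausdorff_gauge s delta C.
Proof.
rewrite /hausdorff_gauge; case: asboolP => // _.
rewrite lee_fin mulr_ge0// mulr_ge0 ?exprn_ge0 ?divr_ge0 ?diam_ge0//.
exact: fine_ge0.
Qed.

Let hausdorff0 s : hausdorff s set0 = 0.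
Proof.
apply/eqP; rewrite eq_le; apply/andP; split.
  apply: ge_ereal_sup => _ [delta _ <-]; rewrite cover_ext0//.
    exact: hausdorff_gauge0.
  exact: hausdorff_gauge_ge0.
apply: ereal_sup_ge; exists 0 => //; exists 1%R; first exact: ltr01.
by rewrite cover_ext0//; [exact: hausdorff_gauge0|exact: hausdorff_gauge_ge0].
Qed.

Let hausdorff_ge0 s A : 0 <= hausdorff s A.
Proof.
apply: le_trans (ereal_sup_ubound _); last by exists 1%R; [exact: ltr01|].
by apply: cover_ext_ge0; exact: hausdorff_gauge_ge0.
Qed.

Let le_hausdorff s : {homo hausdorff s : A B / A `<=` B >-> A <= B}.
Proof.
move=> A B AB; apply: ge_ereal_sup => _ [delta delta0 <-].
apply: le_trans (ereal_sup_ubound _); last by exists delta.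
exact: le_cover_ext.
Qed.

Let hausdorff_sigma_subadditive s : sigma_subadditive (hausdorff s).
Proof.
move=> F; apply: ge_ereal_sup => _ [delta delta0 <-].
apply: (le_trans (cover_ext_sigma_subadditive (hausdorff_gauge_ge0 s delta) F)).
apply: lee_nneseries => k _.
  by move=> _; apply: cover_ext_ge0; exact: hausdorff_gauge_ge0.
by apply: ereal_sup_ubound; exists delta.
Qed.

HB.instance Definition _ s := isOuterMeasure.Build R 'rV[R]_n (hausdorff s)
  (hausdorff0 s) (hausdorff_ge0 s) (@le_hausdorff s)
  (@hausdorff_sigma_subadditive s).

End hausdorff.

Section domain_measures.
Context {R : realType} {m : nat}.
Variable Omega : set 'rV[R]_m.

(* Lebesgue measure on Omega and (m-1)-dimensional Hausdorff measure on its
   boundary, as complete measures on the whole of R^m that only charge Omega,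
   resp. its boundary *)
Definition volume : {measure set (caratheodory_type
    (outer_restr (mu_ext (lebesgue_rV m)) Omega)) -> \bar R} :=
  cara_measure (outer_restr (mu_ext (lebesgue_rV m)) Omega).

Definition bdry : set 'rV[R]_m := closure Omega `\` interior Omega.

Definition surface : {measure set (caratheodory_type
    (outer_restr (hausdorff m.-1) bdry)) -> \bar R} :=
  cara_measure (outer_restr (hausdorff m.-1) bdry).

End domain_measures.

Definition orthonormal_basis d (T : measurableType d) (R : realType)
    (mu : {measure set T -> \bar R}) (e : nat -> L2mean0 mu) :=
  (forall i j, L2_inner (e i) (e j) = (i == j)%:R) /\
  (forall f : L2mean0 mu, series (fun j => L2_inner f (e j) *: e j) @ \oo --> f).

Notation L2 mu := (Lp mu (lee1n 2)).
Notation Linfty mu := (Lp mu (leey 1)).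

Definition L2_dist d (T : measurableType d) (R : realType)
    (mu : {measure set T -> \bar R}) (f g : T -> R) : \bar R :=
  Lnorm mu 2%:E (fun x => (f x - g x)%:E).

Section calculus.
Context {R : realType} {m : nat}.
Implicit Types (f : 'rV[R]_m -> R).

Definition basis_vec (i : 'I_m) : 'rV[R]_m := delta_mx ord0 i.

Definition iter_partial f (s : seq 'I_m) : 'rV[R]_m -> R :=
  foldr (fun i g => 'D_(basis_vec i) g) f s.

Definition smooth f := forall s, continuous (iter_partial f s) /\
  forall i x, derivable (iter_partial f s) x (basis_vec i).

Definition test_function (Omega : set 'rV[R]_m) f := smooth f /\
  exists2 C, compact C & C `<=` Omega /\ forall x, ~ C x -> f x = 0.

(* Near each boundary point, Omega is the strict epigraph, in the direction of a
   unit vector nu, of a Lipschitz function of the projection on the hyperplane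
   orthogonal to nu. *)
Definition lipschitz_boundary (Omega : set 'rV[R]_m) := forall x, bdry Omega x ->
  exists (r : R) (nu : 'rV[R]_m) (gamma : 'rV[R]_m -> R) (k : R),
  [/\ 0 < r, enorm nu = 1, k.-lipschitz gamma &
    forall y, ball x r y ->
      (Omega y <-> gamma (y - dotp y nu *: nu) < dotp y nu)].

Definition bounded_lipschitz_domain (Omega : set 'rV[R]_m) :=
  [/\ Omega !=set0, open Omega, connected Omega, bounded_set Omega &
      lipschitz_boundary Omega].

End calculus.

Section neumann_to_dirichlet.
Context {R : realType} {m : nat} (Omega : set 'rV[R]_m).
Local Notation vol := (volume Omega).
Local Notation surf := (surface Omega).
Local Notation L2b := (L2mean0 surf).

(* u is in H^1(Omega) with gradient G *)
Definition weak_gradient (u : L2 vol) (G : 'I_m -> L2 vol) :=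
  forall phi, test_function Omega phi -> forall i,
    \int[vol]_x (u x * 'D_(basis_vec i) phi x) = - \int[vol]_x (G i x * phi x).

(* The graph of the trace operator H^1(Omega) -> L^2(bdry Omega), i.e., of the
   continuous extension of phi |-> phi|_(bdry Omega) from the restrictions to
   Omega of smooth functions, which are dense in H^1(Omega). *)
Definition has_trace (u : L2 vol) (g : L2 surf) :=
  exists G (phi : nat -> 'rV[R]_m -> R), weak_gradient u G /\
  [/\ forall k, smooth (phi k),
      L2_dist vol (phi k) u @[k --> \oo] --> 0%E,
      forall i, L2_dist vol ('D_(basis_vec i) (phi k)) (G i) @[k --> \oo] --> 0%E &
      L2_dist surf (phi k) g @[k --> \oo] --> 0%E].

Definition Linfty_pos : set (Linfty vol) :=
  [set sigma | (0 < ess_inf vol (EFin \o sigma))%E].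

Definition neumann_solution (sigma : Linfty vol) (f : L2 surf) (u : L2 vol) :=
  exists2 G, weak_gradient u G &
  forall v H t, weak_gradient v H -> has_trace v t ->
    \int[vol]_x (sigma x * \sum_(i < m) G i x * H i x) =
    \int[surf]_x (f x * t x).

Definition is_NtD (Lambda : Linfty vol -> compact_op L2b L2b) :=
  forall sigma, Linfty_pos sigma -> forall f : L2b,
  exists2 u, neumann_solution sigma f u & has_trace u (L2val (Lambda sigma f)).

(* Such a Lambda exists on bounded Lipschitz domains and is unique on
   [Linfty_pos]; the normalization of the solution is that
   [Lambda sigma f : L2b] has mean zero. The values outside of the open set
   [Linfty_pos] are irrelevant. *)
Definition NtD : Linfty vol -> compact_op L2b L2b := xget (fun=> 0) is_NtD.

End neumann_to_dirichlet.

Section real_analytic.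
Context {R : realType} {V W : normedModType R}.

Definition multilinear j (G : ('I_j -> V) -> W) :=
  forall (i : 'I_j) (v : 'I_j -> V) (a : R) (x y : V),
  let subst z := fun k => if k == i then z else v k in
  G (subst (a *: x + y)) = a *: G (subst x) + G (subst y).

Definition symmetric_map j (G : ('I_j -> V) -> W) :=
  forall (s : 'S_j) v, G (v \o s) = G v.

Definition multilinear_norm j (G : ('I_j -> V) -> W) : \bar R :=
  ereal_sup [set `|G v|%:E | v in [set v | forall i, `|v i| <= 1]].

Definition real_analytic (U : set V) (f : V -> W) := forall y, U y ->
  exists (rho : R) (G : forall j, ('I_j -> V) -> W),
  [/\ 0 < rho, ball y rho `<=` U,
      forall j, [/\ multilinear (G j), symmetric_map (G j) &
                    continuous (G j : {ptws 'I_j -> V} -> W)],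
      (\sum_(0 <= j <oo) (multilinear_norm (G j) * (rho ^+ j)%:E) < +oo)%E &
      forall h, `|h| < rho -> series (fun j => G j (fun=> h)) @ \oo --> f (y + h)].

End real_analytic.

Section manifolds.
Context {R : realType} {X : normedModType R} (d : nat).

Definition is_chart (M : set X) (V : set 'rV[R]_d) (phi : 'rV[R]_d -> X) :=
  [/\ open V, real_analytic V phi, forall t, V t -> injective ('d phi t),
      (exists2 W, open W & phi @` V = W `&` M) &
      exists psi : X -> 'rV[R]_d,
        [/\ {in V, cancel phi psi}, {within V, continuous phi} &
            {within phi @` V, continuous psi}]].

Definition analytic_manifold (M : set X) := forall a, M a ->
  exists V phi, is_chart M V phi /\ (phi @` V) a.

Definition tangent_space (M : set X) (a : X) : set X :=
  [set v | exists V phi t w,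
    [/\ is_chart M V phi, V t, phi t = a & v = 'd phi t w]].

End manifolds.

Section finite_dim_span.
Context {R : realType} {V : normedModType R} (e : nat -> V) (N : nat).

Definition lincomb (x : 'rV[R]_N) : V := \sum_(j < N) x ord0 j *: e j.

(* The span of e 0, ..., e N.-1, with the sigma-algebra and the Lebesgue measure
   transported from R^N along x |-> \sum_j x_j e_j *)
Definition fin_span : Type := set_type (range lincomb).
Definition fin_span_val (h : fin_span) : V := set_val h.
Definition to_fin_span (x : 'rV[R]_N) : fin_span :=
  exist _ (lincomb x) (mem_set (imageT lincomb x)).

HB.instance Definition _ := Choice.on fin_span.
HB.instance Definition _ := isPointed.Build fin_span (to_fin_span 0).

Let S : set (set fin_span) := image_set_system setT to_fin_span measurable.
Let fin_span_set0 : S set0. Proof. by rewrite /S /image_set_system/= preimage_set0 setI0. Qed.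
Let span_setC A : S A -> S (~` A).
Proof. by rewrite /S /image_set_system/= !setTI preimage_setC; exact: measurableC. Qed.
Let span_bigcup (F : (set fin_span)^nat) : (forall i, S (F i)) -> S (\bigcup_i F i).
Proof.
rewrite /S /image_set_system/= => mF; rewrite setTI preimage_bigcup.
by apply: bigcup_measurable => i _; have := mF i; rewrite setTI.
Qed.
HB.instance Definition _ :=
  isMeasurable.Build rV_display fin_span fin_span_set0 span_setC span_bigcup.

Definition lebesgue_fin_span : set fin_span -> \bar R :=
  pushforward (@lebesgue_rV R N) to_fin_span.
End finite_dim_span.

Definition iid_sample d d' (T : measurableType d) (T' : measurableType d')
    (R : realType) (P : probability T R) n (X : 'I_n -> {RV P >-> T'})
    (mu : set T' -> \bar R) :=
  (forall i A, measurable A -> distribution P (X i) A = mu A) /\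
  (forall (J : {set 'I_n}) (A : 'I_n -> set T'), (forall i, measurable (A i)) ->
    P (\bigcap_(i in [set i | i \in J]) (X i @^-1` A i)) =
    \prod_(i in J) P (X i @^-1` A i))%E.

(* Main.v *)
Require Import Defs.
(* Write G(s,f) for the gradient of the solution with conductivity s and Neumann
   datum f. Testing each equation with the other solution gives
     <f, (Lam_t - Lam_s) g> = int (s - t) G(s,f).G(t,g),
   and the same identity with ellipticity shows that s |-> G(s,f) is continuous
   into L^2. Hence the coefficients <Lam_s e_i, e_j> are Lipschitz on K and
   their difference quotients along a chart of M converge to
   -int w G(s,e_i).G(s,e_j), w a tangent vector. Compactness of K x K then gives
   N_0: pairs away from the diagonal are separated by injectivity of Lam, pairs
   close to the diagonal by injectivity of the differential and compactness of
   the unit sphere of R^d.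

   For N >= N_0, let B(s) be the N x N matrix of the form (f,g) |-> <Lam_s f, g>
   on H_N. By Lipschitz charts, K is covered by O(p^d) sets of diameter O(1/p),
   so the pairs (s,t) with |B(s) - B(t)| bounded below are covered by O(p^(2d))
   cells, on each of which the event that (B(s) - B(t))(f_l, g_l) = 0 for all l has
   probability O(p^(-M)), up to restricting to samples at which the density of
   rho_N is bounded. As M > 2d, letting p tend to infinity gives probability
   zero. *)
From HB Require Import structures.
From mathcomp Require Import all_boot all_order all_algebra.
From mathcomp Require Import all_classical all_reals all_analysis.
From mathcomp Require Import measurable_realfun ess_sup_inf.
From mathcomp Require Import lra.
Set Implicit Arguments.
Unset Strict Implicit.
Unset Printing Implicit Defensive.
Import Order.TTheory GRing.Theory Num.Theory.
Import numFieldNormedType.Exports.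
Local Open Scope classical_set_scope.
Local Open Scope ring_scope.

(** * Elementary algebra *)

Lemma addr_idem_eq0 (V : zmodType) (x : V) : x = x + x -> x = 0.
Proof. by rewrite -[X in X = _](addr0 x) => /addrI. Qed.

(** The minimum of s a + b / s over s > 0 is twice the square root of a b. For a > 0 the weight s =
    |c| / a already suffices. *)
Lemma sqr_le_of_weighted_sums (R : realFieldType) (a b c : R) : 0 <= a -> 0 <= b ->
  (forall s, 0 < s -> 2 * `|c| <= s * a + s^-1 * b) -> c ^+ 2 <= a * b.
Proof.
move=> a0 b0 h; rewrite -real_normK ?num_real//.
move: `|c| (normr_ge0 c) h => {}c c0 h.
have [->|cN0] := eqVneq c 0; first by rewrite expr0n mulr_ge0.
have {}c0 : 0 < c by rewrite lt_def cN0.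
have [a00|aN0] := eqVneq a 0.
  (* For a = 0 and c nonzero this weight turns the right-hand side into c b / (b + 1), which is less
     than 2 c: a contradiction. *)
  have b1 : 0 < b + 1 by rewrite ltr_wpDl.
  have s0 : 0 < (b + 1) / c by rewrite divr_gt0.
  have := h _ s0; rewrite a00 mulr0 add0r invf_div => h1.
  suff : c / (b + 1) * b < 2 * c by rewrite ltNge h1.
  rewrite mulrAC ltr_pdivrMr// ; nra.
have {}a0 : 0 < a by rewrite lt_def aN0.
have := h (c / a) (divr_gt0 c0 a0).
rewrite divfK// invf_div => h1.
have : c <= a / c * b by lra.
by rewrite mulrAC ler_pdivlMr// expr2.
Qed.

(** * Weighted Dirichlet forms *)

Section Lp_ae.
Context d (T : measurableType d) (R : realType).
Variables (mu : {measure set T -> \bar R}) (p : \bar R) (p1 : (1 <= p)%E).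
Local Open Scope quotient_scope.

Lemma Lp_ae_linear (a : R) (f g : Lp mu p1) :
  ((a *: f + g : Lp mu p1) : T -> R) = (fun x => a * f x + g x) %[ae mu].
Proof.
rewrite -[f]reprK -[g]reprK; move: (repr f) (repr g) => {}f {}g.
rewrite (_ : a *: _ = \pi_(Lp mu p1) (a *: f)); last by rewrite pi_scale.
rewrite -Defs.pi_add.
apply: filter_app (Lp_reprK (a *: f + g)).
apply: filter_app (Lp_reprK f).
apply: filterS (Lp_reprK g) => x gx fx fgx _.
by rewrite /Lp_fun fx// gx// fgx.
Qed.

Lemma measurable_Lp (f : Lp mu p1) : measurable_fun setT (f : T -> R).
Proof. exact: measurable_funPT. Qed.

End Lp_ae.

Section form.
Context d (T : measurableType d) (R : realType) (mu : {measure set T -> \bar R}).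
Context (m : nat).
Local Notation L2 := (L2 mu).
Local Notation Linf := (Linfty mu).
Implicit Types (h k : T -> R) (G H : 'I_m -> L2) (C : R).

(** Weights are functions rather than elements of [Linfty mu], so that the constant weight 1 of
    [energy] is treated like a conductivity. *)
Definition ae_bounded C h :=
  measurable_fun setT h /\ (\forall x \ae mu, `|h x| <= C).

Lemma Linfty_ae_bounded (h : Linf) : ae_bounded `|h| h.
Proof.
split; first exact: measurable_Lp.
(* [Lnorm] at exponent +oo is the essential supremum only if the whole space has positive measure;
   otherwise every property holds almost everywhere. *)
have [mu0|mu0] := eqVneq (mu setT) 0%E.
  exists setT; split => //.
have fin := @Lfunction_finite _ _ _ _ _ (leey 1) (repr h).
have muT : (0 < mu setT)%E by rewrite lt_def mu0 measure_ge0.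
have nE : (`|h|%:E = 'N[mu]_+oo [EFin \o h])%E.
  rewrite /Num.norm/= /Lp_norm fineK// ge0_fin_numE//.
  exact: Lnorm_ge0.
apply: filterS (ess_sup_ge mu (abse \o (EFin \o h))) => x.
move: nE; rewrite unlock /Lnorm muT => <-.
by rewrite /= lee_fin.
Qed.

Lemma integrable_mulL2 (f g : L2) : mu.-integrable setT (EFin \o (fun x => f x * g x)).
Proof. by apply/Lfun1_integrable; apply: Lfun2_mul_Lfun1; exact: LfunP. Qed.

Definition gdot G H x : R := \sum_(i < m) G i x * H i x.

Lemma integrable_gdot G H : mu.-integrable setT (EFin \o gdot G H).
Proof.
rewrite (_ : _ \o _ = fun x => (\sum_(i < m) (EFin \o (fun y => (G i y * H i y)%R)) x)%E).
  by apply: integrable_sum => // i _; exact: integrable_mulL2.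
by apply/funext => x /=; rewrite sumEFin.
Qed.

Lemma integrable_ae_boundedM C h (f : T -> R) : ae_bounded C h ->
  mu.-integrable setT (EFin \o f) ->
  mu.-integrable setT (EFin \o (fun x => h x * f x)).
Proof.
move=> [mh hC] intf; have /integrableP[/measurable_EFinP mf _] := intf.
have mhf : measurable_fun setT (fun x => h x * f x) by exact: measurable_funM.
have /integrableP[mCf fin] := integrableZl measurableT C intf.
apply/integrableP; split; first exact/measurable_EFinP.
apply: le_lt_trans fin; apply: ae_ge0_le_integral => //.
- by apply: measurableT_comp => //; exact/measurable_EFinP.
- by apply: measurableT_comp => //; apply/measurable_EFinP; exact: measurable_funM.
apply: filterS hC => x hx _.
by rewrite /= lee_fin !normrM ler_wpM2r// (le_trans hx)// ler_norm.
Qed.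

Definition form h G H : R := \int[mu]_x (h x * gdot G H x).

Lemma integrable_form C h G H : ae_bounded C h ->
  mu.-integrable setT (EFin \o (fun x => h x * gdot G H x)).
Proof. by move=> hC; apply: integrable_ae_boundedM hC _; exact: integrable_gdot. Qed.

Lemma eq_Rintegral_ae (f g : T -> R) : measurable_fun setT f ->
  measurable_fun setT g -> (\forall x \ae mu, f x = g x) ->
  \int[mu]_x f x = \int[mu]_x g x.
Proof.
move=> mf mg fg; rewrite /Rintegral; congr fine; apply: ae_eq_integral => //.
- exact/measurable_EFinP.
- exact/measurable_EFinP.
- by apply: filterS fg => x -> _.
Qed.

Lemma formC h G H : form h G H = form h H G.
Proof.
rewrite /form; apply: eq_Rintegral => x _; congr (_ * _).
by apply: eq_bigr => i _; rewrite mulrC.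
Qed.

Lemma measurable_gdot G H : measurable_fun setT (gdot G H).
Proof. by have /integrableP[/measurable_EFinP] := integrable_gdot G H. Qed.

Lemma form_linear C h a G G' H : ae_bounded C h ->
  form h (a *: G + G') H = a * form h G H + form h G' H.
Proof.
move=> hC; have mh := hC.1.
have intGH := integrable_form G H hC.
rewrite /form -RintegralZl// -RintegralD//; last 2 first.
- exact: (integrableZl measurableT a intGH).
- exact: integrable_form hC.
apply: eq_Rintegral_ae.
- by apply: measurable_funM => //; exact: measurable_gdot.
- apply: measurable_funD; first apply: measurable_funM => //.
  + by apply: measurable_funM => //; exact: measurable_gdot.
  + by apply: measurable_funM => //; exact: measurable_gdot.
have : \forall x \ae mu, forall i, (a *: G i + G' i : L2) x = a * G i x + G' i x.
  apply: filter_forall => i.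
  by apply: filterS (Lp_ae_linear a (G i) (G' i)) => x; exact.
apply: filterS => x GG'.
rewrite mulrCA -mulrDr; congr (_ * _).
rewrite /gdot mulr_sumr -big_split/=; apply: eq_bigr => i _.
rewrite -[(a *: G + G') i]/(a *: G i + G' i : L2) GG'; lra.
Qed.

Lemma formZ C h a G H : ae_bounded C h -> form h (a *: G) H = a * form h G H.
Proof.
move=> hC; have h0 : form h 0 H = 0.
  by apply: addr_idem_eq0; rewrite -[in LHS](addr0 0) -{1}[0]scale1r (form_linear _ _ _ _ hC) mul1r.
by rewrite -[in LHS](addr0 (a *: G)) (form_linear _ _ _ _ hC) h0 addr0.
Qed.

Lemma form_linear_weight C C' k h h' a G H : ae_bounded C h -> ae_bounded C' h' ->
  measurable_fun setT k -> (\forall x \ae mu, k x = a * h x + h' x) ->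
  form k G H = a * form h G H + form h' G H.
Proof.
move=> hC hC' mk kE.
have intGH := integrable_form G H hC.
rewrite /form -RintegralZl// -RintegralD//; last 2 first.
- exact: (integrableZl measurableT a intGH).
- exact: integrable_form hC'.
apply: eq_Rintegral_ae.
- by apply: measurable_funM => //; exact: measurable_gdot.
- apply: measurable_funD; first apply: measurable_funM => //.
  + by apply: measurable_funM; [exact: hC.1|exact: measurable_gdot].
  + by apply: measurable_funM; [exact: hC'.1|exact: measurable_gdot].
by apply: filterS kE => x ->; rewrite mulrDl mulrA.
Qed.

Lemma form_Linfty_linear (a : R) (h h' : Linf) G H :
  form (a *: h + h' : Linf) G H = a * form h G H + form h' G H.
Proof.
apply: (form_linear_weight (C := `|h|) (C' := `|h'|)); try exact: Linfty_ae_bounded.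
  exact: measurable_Lp.
by apply: filterS (Lp_ae_linear a h h') => x; exact.
Qed.

Lemma ae_bounded_cst1 : ae_bounded 1 (cst 1).
Proof. by split => //; apply: nearW => x; rewrite normr1. Qed.

Definition energy G : R := form (cst 1) G G.

Lemma le_ae_Rintegral (f g : T -> R) : mu.-integrable setT (EFin \o f) ->
  mu.-integrable setT (EFin \o g) -> (\forall x \ae mu, f x <= g x) ->
  \int[mu]_x f x <= \int[mu]_x g x.
Proof.
move=> intf intg fg.
have [/measurable_EFinP mf _] := integrableP _ _ _ intf.
have [/measurable_EFinP mg _] := integrableP _ _ _ intg.
have mgf : measurable_fun setT (fun x => g x - f x) by exact: measurable_funB.
rewrite -subr_ge0 -RintegralB// (@eq_Rintegral_ae _ (fun x => `|g x - f x|))//.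
- exact: Rintegral_ge0.
- exact: measurableT_comp.
- by apply: filterS fg => x fgx; rewrite ger0_norm// subr_ge0.
Qed.

Lemma gdot_ge0 G x : 0 <= gdot G G x.
Proof. by apply: sumr_ge0 => i _; exact: sqr_ge0. Qed.

Lemma energy_ge0 G : 0 <= energy G.
Proof. by apply: Rintegral_ge0 => x _; rewrite mul1r gdot_ge0. Qed.

Lemma form_coercive C h l G : ae_bounded C h -> (\forall x \ae mu, l <= h x) ->
  l * energy G <= form h G G.
Proof.
move=> hC lh; rewrite /energy /form -RintegralZl//; last first.
  exact: integrable_form ae_bounded_cst1.
apply: le_ae_Rintegral.
- exact: (integrableZl measurableT l (integrable_form G G ae_bounded_cst1)).
- exact: integrable_form hC.
by apply: filterS lh => x lx; rewrite mul1r ler_wpM2r// gdot_ge0.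
Qed.

(** Young's inequality 2 |x y| <= x^2 + y^2, applied pointwise to each component. *)
Lemma form_le_energy C h G H : ae_bounded C h ->
  2 * `|form h G H| <= C * (energy G + energy H).
Proof.
move=> hC; have intGH := integrable_form G H hC.
have i1 := integrable_form G G ae_bounded_cst1.
have i2 := integrable_form H H ae_bounded_cst1.
have intn : mu.-integrable setT (EFin \o (fun x => `|h x * gdot G H x|)).
  exact: (integrable_abse intGH).
have i12 : mu.-integrable setT
    (EFin \o (fun x => cst 1 x * gdot G G x + cst 1 x * gdot H H x)).
  exact: (integrableD _ i1 i2).
have : 2 * `|form h G H| <= 2 * \int[mu]_x `|h x * gdot G H x|.
  by rewrite ler_pM2l//; exact: le_normr_Rintegral.
move=> /le_trans; apply.
rewrite /energy/form -RintegralD// -RintegralZl// -RintegralZl//.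
apply: le_ae_Rintegral.
- exact: (integrableZl measurableT 2 intn).
- exact: (integrableZl measurableT C i12).
case: hC => _; apply: filterS => x hx; rewrite /= !mul1r normrM mulrCA.
apply: ler_pM => //.
rewrite /gdot -big_split/=.
rewrite (le_trans (_ : _ <= 2 * \sum_(i < m) `|G i x * H i x|))//.
  by rewrite ler_pM2l//; exact: ler_norm_sum.
rewrite mulr_sumr; apply: ler_sum => i _.
have := sqr_ge0 (`|G i x| - `|H i x|).
rewrite normrM sqrrB !real_normK ?num_real// !expr2; lra.
Qed.

Lemma energyD G H : energy (G + H) <= 2 * (energy G + energy H).
Proof.
have e1 (G1 G2 H1 : 'I_m -> L2) :
    form (cst 1) (G1 + G2) H1 = form (cst 1) G1 H1 + form (cst 1) G2 H1.
  by rewrite -[in LHS](scale1r G1) (form_linear _ _ _ _ ae_bounded_cst1) mul1r.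
rewrite /energy e1 ![form _ _ (G + H)]formC !e1.
rewrite [form _ H G]formC.
have := form_le_energy G H ae_bounded_cst1.
have := ler_norm (form (cst 1) G H).
rewrite /energy; lra.
Qed.

Lemma energyZ a G : energy (a *: G) = a ^+ 2 * energy G.
Proof.
by rewrite /energy (formZ _ _ _ ae_bounded_cst1) formC (formZ _ _ _ ae_bounded_cst1) mulrA expr2.
Qed.

(** Multiplying G by the square root of s and dividing H by it preserves the form and weights the
    energies by s and 1 / s in [form_le_energy]; then s is optimized. *)
Lemma form_cauchy_schwarz C h G H : 0 <= C -> ae_bounded C h ->
  form h G H ^+ 2 <= (C * energy G) * (C * energy H).
Proof.
move=> C0 hC; apply: sqr_le_of_weighted_sums; rewrite ?mulr_ge0 ?energy_ge0//.
move=> s s0.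
have := form_le_energy (Num.sqrt s *: G) ((Num.sqrt s)^-1 *: H) hC.
rewrite (formZ _ _ _ hC) formC (formZ _ _ _ hC) mulrA mulfV ?gt_eqF ?sqrtr_gt0// mul1r formC !energyZ.
rewrite exprVn (sqr_sqrtr (ltW s0)); lra.
Qed.

End form.

(** * Inner products and compact operators *)

Section L2_inner_theory.
Context d (T : measurableType d) (R : realType) (mu : {measure set T -> \bar R}).
Local Notation L2 := (L2 mu).
Implicit Types f g : L2.

Lemma L2_innerC f g : L2_inner f g = L2_inner g f.
Proof. by apply: eq_Rintegral => x _; rewrite mulrC. Qed.

Lemma L2_inner_linearl (a : R) f f' g :
  L2_inner (a *: f + f') g = a * L2_inner f g + L2_inner f' g.
Proof.
rewrite /L2_inner -RintegralZl//; last exact: integrable_mulL2.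
rewrite -RintegralD//; last 2 first.
- exact: (integrableZl measurableT a (integrable_mulL2 f g)).
- exact: integrable_mulL2.
apply: eq_Rintegral_ae.
- by apply: measurable_funM => //; exact: measurable_Lp.
- apply: measurable_funD; first apply: measurable_funM => //.
  + by apply: measurable_funM => //; exact: measurable_Lp.
  + by apply: measurable_funM => //; exact: measurable_Lp.
apply: filterS (Lp_ae_linear a f f') => x /(_ I) ->.
by rewrite mulrDl mulrA.
Qed.

Lemma L2_inner_le f g : `|L2_inner f g| <= `|f| * `|g|.
Proof.
have ifg := integrable_mulL2 f g.
apply: (le_trans (le_normr_Rintegral measurableT ifg)).
have nE (h : L2) : `|h|%:E = ('N[mu]_2%:E [EFin \o h])%E.
  rewrite /Num.norm/= /Lp_norm fineK// ge0_fin_numE ?Lnorm_ge0//.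
  exact: (@Lfunction_finite _ _ _ _ _ (lee1n 2) (repr h)).
rewrite -lee_fin EFinM !nE.
apply: le_trans (hoelder mu (measurable_Lp f) (measurable_Lp g) _ _ _) => //.
  rewrite Lnorm1 fineK//.
  have := integrable_abse ifg => /(integrable_fin_num measurableT).
  by [].
by rewrite [RHS]splitr !div1r.
Qed.

End L2_inner_theory.

Section mean_zero_inner.
Context d (T : measurableType d) (R : realType) (nu : {measure set T -> \bar R}).
Local Notation L2b := (L2mean0 nu).
Implicit Types f g : L2b.

Definition inner f g : R := L2_inner f g.

Lemma innerC f g : inner f g = inner g f.
Proof. exact: L2_innerC. Qed.

Lemma inner_linearl a f f' g : inner (a *: f + f') g = a * inner f g + inner f' g.
Proof. exact: L2_inner_linearl. Qed.

Lemma inner_le f g : `|inner f g| <= `|f| * `|g|.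
Proof. exact: L2_inner_le. Qed.

Lemma inner0l g : inner 0 g = 0.
Proof.
by apply: addr_idem_eq0; have := inner_linearl 1 0 0 g; rewrite scaler0 addr0 mul1r.
Qed.

Lemma innerDl f f' g : inner (f + f') g = inner f g + inner f' g.
Proof. by rewrite -[in LHS](scale1r f) inner_linearl mul1r. Qed.

Lemma innerZl a f g : inner (a *: f) g = a * inner f g.
Proof. by rewrite -[in LHS](addr0 (a *: f)) inner_linearl inner0l addr0. Qed.

Lemma inner_suml (I : Type) (r : seq I) (F : I -> L2b) g :
  inner (\sum_(i <- r) F i) g = \sum_(i <- r) inner (F i) g.
Proof. by elim/big_ind2: _ => [|x1 x2 y1 y2 <- <-|]; rewrite ?inner0l ?innerDl. Qed.

Lemma innerBl f f' g : inner (f - f') g = inner f g - inner f' g.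
Proof. by rewrite innerDl -scaleN1r innerZl mulN1r. Qed.

End mean_zero_inner.

Section compact_op_theory.
Context (R : realType) (V W : normedModType R).
Implicit Types A : compact_op V W.

Lemma compact_op_linear A a x y : A (a *: x + y) = a *: A x + A y.
Proof. by have := compact_opP A; rewrite inE => -[lA _]; exact: lA. Qed.

Lemma compact_op0 A : A 0 = 0.
Proof.
by apply: addr_idem_eq0; have := compact_op_linear A 1 0 0; rewrite !scale1r addr0.
Qed.

Lemma compact_opZ A a x : A (a *: x) = a *: A x.
Proof. by rewrite -[in LHS](addr0 (a *: x)) compact_op_linear compact_op0 addr0. Qed.

Lemma compact_opD A x y : A (x + y) = A x + A y.
Proof. by rewrite -[in LHS](scale1r x) compact_op_linear scale1r. Qed.

Lemma compact_op_sum A (I : Type) (r : seq I) (F : I -> V) :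
  A (\sum_(i <- r) F i) = \sum_(i <- r) A (F i).
Proof. by elim/big_ind2: _ => [|x1 x2 y1 y2 <- <-|]; rewrite ?compact_op0 ?compact_opD. Qed.

Lemma compact_op_le A x : `|A x| <= `|A| * `|x|.
Proof.
have [->|x0] := eqVneq x 0; first by rewrite compact_op0 !normr0 mulr0.
have := op_norm_ub A (_ : `| `|x|^-1 *: x| <= 1).
rewrite normrZ normfV normr_id mulVf ?normr_eq0// => /(_ (lexx _)).
by rewrite compact_opZ normrZ normfV normr_id ler_pdivrMl ?normr_gt0// mulrC.
Qed.

Lemma compact_op_addE A B x : (A + B) x = A x + B x.
Proof. by []. Qed.

End compact_op_theory.

Section separation.
Context d (T : measurableType d) (R : realType) (nu : {measure set T -> \bar R}).
Local Notation L2b := (L2mean0 nu).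

(** Each A e_j vanishes because its expansion in the basis does. So A vanishes on the partial sums
    of any f, which converge to f, and A is bounded. *)
Lemma compact_op_separated (e : nat -> L2b) (A : compact_op L2b L2b) :
  orthonormal_basis e -> (forall i j, inner (e i) (A (e j)) = 0) -> A = 0.
Proof.
move=> [_ he] A0.
have Ae j : A (e j) = 0.
  apply/esym/(cvg_unique (@norm_hausdorff _ L2b) _ (he (A (e j)))).
  rewrite (_ : series _ = cst 0); first exact: cvg_cst.
  apply/funext => n; rewrite /series/= big1// => i _.
  by rewrite [L2_inner _ _]innerC A0 scale0r.
apply/val_inj/funext => f /=.
have /cvgrPdist_lt hf := he f.
apply/eqP; rewrite -normr_le0; apply/ler_addgt0Pr => eps eps0; rewrite add0r.
have A1 : 0 < `|A| + 1 by rewrite ltr_wpDl.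
have [n _ /(_ n (leqnn n))] := hf _ (divr_gt0 eps0 A1).
set s := series _ n => fs.
have As0 : A s = 0.
  rewrite /s/series/= compact_op_sum big1// => i _.
  by rewrite compact_opZ Ae scaler0.
have -> : A f = A (f - s) by rewrite -scaleN1r addrC compact_op_linear As0 scaler0 add0r.
apply: (le_trans (compact_op_le A (f - s))).
rewrite ltr_pdivlMr// in fs.
apply: le_trans (ltW fs); rewrite mulrC.
by rewrite ler_wpM2l// lerDl.
Qed.

End separation.

(** * Continuity and differentiation of the Neumann-to-Dirichlet map *)

Section gradient_fields.
Context d (T : measurableType d) (R : realType) (mu : {measure set T -> \bar R}).
Context d' (T' : measurableType d') (nu : {measure set T' -> \bar R}) (m : nat).
Local Notation Linf := (Linfty mu).
Local Notation L2b := (L2mean0 nu).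
Variables (Lam : Linf -> compact_op L2b L2b) (Gr : Linf -> L2b -> 'I_m -> L2 mu).
Implicit Types (sigma tau h w : Linf) (f g : L2b) (l eps delta : R).

(** The set [Linfty_pos], over an arbitrary measure in place of the volume on Omega. *)
Definition elliptic : set Linf := [set sigma | (0 < ess_inf mu (EFin \o sigma))%E].

Definition bounded_below l sigma := \forall x \ae mu, l <= (sigma : T -> R) x.

(* The weak equation for sigma, f tested with the solution for tau, g. *)
Hypothesis GrE : forall sigma tau f g, elliptic sigma -> elliptic tau ->
  form sigma (Gr sigma f) (Gr tau g) = inner f (Lam tau g).

(** If sigma >= l almost everywhere, a perturbation of norm less than l / 2 stays above l / 2. *)
Lemma elliptic_near sigma : elliptic sigma -> exists2 l, 0 < l &
  forall tau, `|tau - sigma| < l -> bounded_below l tau /\ elliptic tau.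
Proof.
rewrite /elliptic/= => s0.
have [l l0 ls] : exists2 l : R, 0 < l & (l%:E <= ess_inf mu (EFin \o sigma))%E.
  (* The essential infimum may be +oo, on a space of measure zero; any positive l is then a lower
     bound. *)
  case: (ess_inf _ _) s0 => [r|_|//]; first by exists r.
  by exists 1; rewrite ?leey.
exists (l / 2); first by rewrite divr_gt0.
move=> tau taus.
have bt : bounded_below (l / 2) tau.
  have [_ bts] := Linfty_ae_bounded (tau - sigma).
  apply: filter_app bts; apply: filter_app (Lp_ae_linear (-1) sigma tau).
  apply: filterS (ess_inf_le mu (EFin \o sigma)) => x sx.
  move=> /(_ I); rewrite scaleN1r addrC => -> tsx.
  have {}sx : l <= (sigma : T -> R) x by rewrite -lee_fin (le_trans ls).
  have := le_lt_trans tsx taus.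
  by rewrite ltr_norml mulN1r => /andP[]; lra.
split => //; rewrite (@lt_le_trans _ _ (l / 2)%:E)//.
  by rewrite lte_fin divr_gt0.
by apply/ess_infP; apply: filterS bt => x; rewrite /= lee_fin.
Qed.

Lemma Linfty_formBl h h' G H :
  @form _ _ _ mu m (h - h' : Linf) G H = form h G H - form h' G H.
Proof. by rewrite addrC -scaleN1r form_Linfty_linear mulN1r addrC. Qed.

Lemma Linfty_form0 G H : @form _ _ _ mu m (0 : Linf) G H = 0.
Proof. by rewrite -(subrr (0 : Linf)) Linfty_formBl subrr. Qed.

Lemma Linfty_formZl (a : R) h G H :
  @form _ _ _ mu m (a *: h : Linf) G H = a * form h G H.
Proof. by rewrite -[in LHS](addr0 (a *: h)) form_Linfty_linear Linfty_form0 addr0. Qed.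

Lemma Linfty_formB h (G G' H : 'I_m -> L2 mu) : form h (G - G') H = form h G H - form h G' H.
Proof.
by rewrite addrC -scaleN1r (form_linear _ _ _ _ (Linfty_ae_bounded h)) mulN1r addrC.
Qed.

Lemma Linfty_form_le h (G H : 'I_m -> L2 mu) :
  2 * `|form h G H| <= `|h| * (energy G + energy H).
Proof. exact: form_le_energy (Linfty_ae_bounded h). Qed.

Lemma Linfty_formBr h (G H H' : 'I_m -> L2 mu) : form h G (H - H') = form h G H - form h G H'.
Proof. by rewrite formC Linfty_formB !(formC _ G). Qed.

Lemma inner_NtDC sigma f g : elliptic sigma ->
  inner f (Lam sigma g) = inner g (Lam sigma f).
Proof. by move=> s0; rewrite -(GrE f g s0 s0) -(GrE g f s0 s0) formC. Qed.

(** By symmetry of [Lam sigma], both pairings are forms of the same two fields, with weight sigma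
    for the first and tau for the second. *)
Lemma inner_NtDB sigma tau f g : elliptic sigma -> elliptic tau ->
  inner f (Lam tau g) - inner f (Lam sigma g) =
  form (sigma - tau : Linf) (Gr sigma f) (Gr tau g).
Proof.
move=> s0 t0; rewrite Linfty_formBl (GrE _ _ s0 t0); congr (_ - _).
by rewrite (inner_NtDC f g s0) -(GrE _ _ t0 s0) formC.
Qed.

(** Testing both equations with the difference D of the two solutions gives int tau |D|^2 = int
    (sigma - tau) G(sigma,f).D. Coercivity bounds the left side from below, Young's inequality the
    right side from above, and the resulting energy of D is absorbed on the left. *)
Lemma energy_gradientB l sigma tau f : elliptic sigma -> elliptic tau ->
  bounded_below l tau -> `|tau - sigma| <= l ->
  l * energy (Gr tau f - Gr sigma f) <= `|tau - sigma| * energy (Gr sigma f).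
Proof.
move=> s0 t0 lt tsl; set D := _ - _.
have h1 : form tau D D = form (sigma - tau : Linf) (Gr sigma f) D.
  rewrite Linfty_formBl [LHS]Linfty_formB; congr (_ - _).
  by rewrite !Linfty_formBr (GrE f f t0 t0) (GrE f f t0 s0) (GrE f f s0 s0) (GrE f f s0 t0).
have := form_coercive D (Linfty_ae_bounded tau) lt.
rewrite h1 => h2.
have h3 := Linfty_form_le (sigma - tau) (Gr sigma f) D.
have h4 := ler_norm (form (sigma - tau : Linf) (Gr sigma f) D).
rewrite distrC in h3.
have h5 : `|tau - sigma| * energy D <= l * energy D.
  by rewrite ler_wpM2r// energy_ge0.
lra.
Qed.

Lemma energy_gradient_near sigma f : elliptic sigma -> exists2 l, 0 < l &
  forall tau, `|tau - sigma| < l -> elliptic tau /\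
  l * energy (Gr tau f - Gr sigma f) <= `|tau - sigma| * energy (Gr sigma f).
Proof.
move=> s0; have [l l0 sl] := elliptic_near s0; exists l => // tau tsl.
have [lt t0] := sl _ tsl; split => //.
by apply: energy_gradientB => //; exact: ltW.
Qed.

Lemma energy_gradient_bounded sigma f : elliptic sigma -> exists2 l, 0 < l &
  forall tau, `|tau - sigma| < l -> energy (Gr tau f) <= 4 * energy (Gr sigma f).
Proof.
move=> s0; have [l l0 sl] := energy_gradient_near f s0; exists l => // tau tsl.
have [t0 h] := sl _ tsl.
have h1 : energy (Gr tau f - Gr sigma f) <= energy (Gr sigma f).
  rewrite -(ler_pM2l l0) (le_trans h)// ler_wpM2r ?energy_ge0//.
  exact: ltW.
have := energyD (Gr tau f - Gr sigma f) (Gr sigma f).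
by rewrite subrK; lra.
Qed.

(** The weight and the two fields are changed one at a time. The change of weight costs |h - w|
    times bounded energies; the changes of fields are small by Cauchy-Schwarz, since their energies
    are O(|sigma_i - sigma|). *)
Lemma form_gradient_continuous sigma w f g eps : elliptic sigma -> 0 < eps ->
  exists2 delta, 0 < delta & forall sigma1 sigma2 h,
    `|sigma1 - sigma| < delta -> `|sigma2 - sigma| < delta -> `|h - w| < delta ->
    `|form h (Gr sigma1 f) (Gr sigma2 g) - form w (Gr sigma f) (Gr sigma g)| < eps.
Proof.
move=> s0 eps0.
have [l1 l10 sl1] := energy_gradient_near f s0.
have [l2 l20 sl2] := energy_gradient_near g s0.
have [l3 l30 sl3] := energy_gradient_bounded f s0.
have [l4 l40 sl4] := energy_gradient_bounded g s0.
have [a aE] : exists a, a = energy (Gr sigma f) by exists (energy (Gr sigma f)).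
have [b bE] : exists b, b = energy (Gr sigma g) by exists (energy (Gr sigma g)).
have a0 : 0 <= a by rewrite aE energy_ge0.
have b0 : 0 <= b by rewrite bE energy_ge0.
(* The energies of G1 and G2 are at most 4 a and 4 b, hence their sum is at most 2 A; the added 1
   makes A positive. *)
have [A AE] : exists A, A = 2 * (a + b) + 1 by exists (2 * (a + b) + 1).
have A0 : 0 < A by lra.
have l120 : 0 < Num.min l1 l2 by rewrite lt_min l10.
(* B |sigma_i - sigma| dominates the Cauchy-Schwarz product in both field terms: the changed field
   contributes |sigma_i - sigma| / min(l1, l2), the other one at most the factor 4. Each of the
   three terms ends up at most eps / 4. *)
have [B BE] : exists B, B = (`|w| * (4 * a) * (`|w| * (4 * b))) / Num.min l1 l2 + 1 by eexists.
have B0 : 0 < B.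
  by rewrite BE ltr_wpDl// divr_ge0 ?(ltW l120)// !mulr_ge0.
pose delta := Num.min (Num.min (Num.min l1 l2) (Num.min l3 l4))
  (Num.min (eps / 4 / A) ((eps / 4) ^+ 2 / B)).
have e40 : 0 < eps / 4 by rewrite divr_gt0.
exists delta.
  by rewrite !lt_min l10 l20 l30 l40/= !divr_gt0// exprn_gt0.
move=> sigma1 sigma2 h; rewrite /delta !lt_min.
move=> /and3P[/andP[/andP[d11 d12] /andP[d13 d14]] d1A d1B].
move=> /and3P[/andP[/andP[d21 d22] /andP[d23 d24]] d2A d2B].
move=> /and3P[_ dhA _].
have [_ e1] := sl1 _ d11; have [_ e2] := sl2 _ d22.
have := sl3 _ d13; have := sl4 _ d24; rewrite -aE -bE => e4 e3.
move: e1 e2; rewrite -aE -bE.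
set G1 := Gr sigma1 f in e3 *; set G2 := Gr sigma2 g in e4 *.
set G := Gr sigma f in aE *; set G' := Gr sigma g in bE * => e1 e2.
have -> : form h G1 G2 - form w G G' =
    form (h - w : Linf) G1 G2 + form w (G1 - G) G2 + form w G (G2 - G').
  by rewrite Linfty_formBl Linfty_formB Linfty_formBr; lra.
have t1 : `|form (h - w : Linf) G1 G2| <= eps / 4.
  have := Linfty_form_le (h - w) G1 G2.
  rewrite ltr_pdivlMr// in dhA.
  have : `|h - w| * (energy G1 + energy G2) <= `|h - w| * (2 * A).
    by rewrite ler_wpM2l//; lra.
  lra.
have sq (H1 H2 : 'I_m -> L2 mu) (x y c : R) : energy H1 <= x -> energy H2 <= y ->
    (`|w| * x) * (`|w| * y) <= c * B -> c < (eps / 4) ^+ 2 / B ->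
    `|form w H1 H2| <= eps / 4.
  move=> h1 h2 h3; rewrite ltr_pdivlMr// => h4.
  rewrite -(@ler_pXn2r _ 2)// ?nnegrE ?(ltW e40)// real_normK ?num_real//.
  apply: le_trans (form_cauchy_schwarz H1 H2 (normr_ge0 w) (Linfty_ae_bounded w)) _.
  apply: le_trans (le_trans h3 (ltW h4)).
  by apply: ler_pM; rewrite ?mulr_ge0 ?energy_ge0// ler_wpM2l.
have e1' : energy (G1 - G) <= `|sigma1 - sigma| / Num.min l1 l2 * a.
  rewrite mulrAC ler_pdivlMr// mulrC (le_trans _ e1)//.
  by rewrite ler_wpM2r ?energy_ge0// ge_min lexx.
have e2' : energy (G2 - G') <= `|sigma2 - sigma| / Num.min l1 l2 * b.
  rewrite mulrAC ler_pdivlMr// mulrC (le_trans _ e2)//.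
  by rewrite ler_wpM2r ?energy_ge0// ge_min lexx orbT.
have P0 : 0 <= `|w| * a * (`|w| * b) / Num.min l1 l2.
  by rewrite divr_ge0 ?(ltW l120)// !mulr_ge0.
have t2 : `|form w (G1 - G) G2| <= eps / 4.
  apply: (sq _ _ _ _ `|sigma1 - sigma| e1' e4) => //.
  have : 0 <= `|sigma1 - sigma| * (12 * (`|w| * a * (`|w| * b) / Num.min l1 l2) + 1).
    by rewrite mulr_ge0// addr_ge0// mulr_ge0.
  rewrite BE; lra.
have t3 : `|form w G (G2 - G')| <= eps / 4.
  apply: (sq _ _ a _ `|sigma2 - sigma| _ e2') => //; first by rewrite aE.
  have : 0 <= `|sigma2 - sigma| * (15 * (`|w| * a * (`|w| * b) / Num.min l1 l2) + 1).
    by rewrite mulr_ge0// addr_ge0// mulr_ge0.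
  rewrite BE; lra.
rewrite (le_lt_trans (ler_normD _ _))//.
have := ler_normD (form (h - w : Linf) G1 G2) (form w (G1 - G) G2).
lra.
Qed.
End gradient_fields.

(* Junk value of ['d]: the default point of the type of linear maps is 0. *)
Lemma diff_not_differentiable (R : realType) (V W : normedModType R) (f : V -> W) x :
  ~ differentiable f x -> 'd f x = \0 :> (V -> W).
Proof.
move=> nd; rewrite /diff getPN// => df [cdf fE]; apply: nd; apply/diffP.
apply: (@getPex _ (fun df : {linear V -> W} => continuous df /\
  forall y, f y = f (lim (nbhs x)) + df (y - lim (nbhs x)) +o_(y \near x) (y - lim (nbhs x)))).
by exists df.
Qed.

(** Passage from neighbourhoods to a compact set; it serves for covering numbers and for energy
    bounds. *)
Lemma compact_set_ideal (X : topologicalType) (K : set X) (P : set X -> Prop) :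
  compact K -> P set0 -> (forall A B, P A -> P B -> P (A `|` B)) ->
  (forall A B, A `<=` B -> P B -> P A) ->
  (forall x, K x -> exists2 U, nbhs x U & P (K `&` U)) -> P K.
Proof.
move=> cK P0 PU PS Ploc.
(* The complements of the sets satisfying P form a filter without cluster point. *)
pose F := [set A : set X | P (K `\` A)].
have FF : Filter F.
  split; rewrite /F/=.
  - by rewrite setDT.
  - move=> A B PA PB; apply: PS (PU _ _ PA PB) => x [Kx] /not_andP[nA|nB].
      by left.
    by right.
  - by move=> A B AB; apply: PS; exact: setDS.
apply: contrapT => nPK.
have PF : ProperFilter F by split => //; rewrite /F/= setD0.
have FK : F K by rewrite /F/= setDv.
have [x [Kx clx]] := cK _ PF FK.
have [U Ux PKU] := Ploc _ Kx.
have FU : F (~` U) by rewrite /F/= setDE setCK.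
by have [y [nUy Uy]] := clx _ _ FU Ux.
Qed.

Section NtD_differential.
Context d (T : measurableType d) (R : realType) (mu : {measure set T -> \bar R}).
Context d' (T' : measurableType d') (nu : {measure set T' -> \bar R}) (m : nat).
Local Notation Linf := (Linfty mu).
Local Notation L2b := (L2mean0 nu).
Variables (Lam : Linf -> compact_op L2b L2b) (Gr : Linf -> L2b -> 'I_m -> L2 mu).
Hypothesis GrE : forall sigma tau f g, elliptic sigma -> elliptic tau ->
  form sigma (Gr sigma f) (Gr tau g) = inner f (Lam tau g).

(* Where Lam is differentiable, ['d Lam sigma w] is tested with the e_i, e_j along
   the line of direction w; elsewhere it is 0. *)
Lemma differential_NtD_eq0 (e : nat -> L2b) (sigma w : Linf) : orthonormal_basis e ->
  elliptic sigma ->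
  (forall i j, form w (Gr sigma (e i)) (Gr sigma (e j)) = 0) -> 'd Lam sigma w = 0.
Proof.
move=> he s0 w0; have [dL|ndL] := pselect (differentiable Lam sigma); last first.
  by rewrite (diff_not_differentiable ndL).
rewrite -deriveE//; set A := 'D_w Lam sigma.
have : (fun h => h^-1 *: ((Lam \o shift sigma) (h *: w) - Lam sigma)) @ 0^' --> A.
  exact: (diff_derivable dL).
move=> /cvgrPdist_lt LA.
apply: (compact_op_separated he) => i j.
apply/eqP; rewrite -normr_le0; apply/ler_addgt0Pr => eps eps0; rewrite add0r.
have e20 : 0 < eps / 2 by rewrite divr_gt0.
have [delta d0 dP] := form_gradient_continuous GrE w (e i) (e j) s0 e20.
have [l l0 lP] := elliptic_near s0.
(* The error of the difference quotient is paired with e_i and e_j, which costs the product of their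
   norms; the added 1 keeps the divisor positive. *)
have eij0 : 0 < `|e i| * `|e j| + 1 by rewrite ltr_wpDl// mulr_ge0.
have [h [h0 hw hA]] : exists h : R, [/\ h != 0, `|h *: w| < Num.min delta l &
    `|A - h^-1 *: (Lam (h *: w + sigma) - Lam sigma)| < eps / 2 / (`|e i| * `|e j| + 1)].
  have wcvg : (fun h : R => h *: w) @ 0^' --> (0 : Linf).
    rewrite -(scale0r w); apply: cvgZr_tmp; apply: cvg_within_filter.
    exact: cvg_id.
  have m0 : 0 < Num.min delta l by rewrite lt_min d0.
  have q0 : 0 < eps / 2 / (`|e i| * `|e j| + 1) by rewrite divr_gt0.
  move/cvgrPdist_lt : wcvg => /(_ _ m0) wcvg.
  near (0 : R)^' => h; exists h; split.
  - by near: h; exact: nbhs_dnbhs_neq.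
  - by rewrite -normrN -sub0r; near: h; exact: wcvg.
  - by near: h; exact: LA.
move: hw; rewrite lt_min => /andP[hwd hwl].
set tau := h *: w + sigma in hA.
have tE : tau - sigma = h *: w by rewrite /tau addrK.
have [_ t0] : bounded_below l tau /\ elliptic tau by apply: lP; rewrite tE.
(* The coefficient of the quotient is minus the form with weight w of the fields at sigma and tau,
   close to its value 0 for both fields at sigma. *)
have q1 : `|inner (e i) ((h^-1 *: (Lam tau - Lam sigma)) (e j))| < eps / 2.
  rewrite innerC innerZl innerBl ![inner _ (e i)]innerC (inner_NtDB GrE)//.
  rewrite -Linfty_formZl -opprB tE scalerN scalerA mulVf// scale1r.
  have := dP sigma tau w; rewrite !subrr normr0 tE => /(_ d0 hwd d0).
  by rewrite w0 subr0 -scaleN1r Linfty_formZl mulN1r normrN.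
have q2 : `|inner (e i) ((A - h^-1 *: (Lam tau - Lam sigma)) (e j))| <= eps / 2.
  apply: le_trans (inner_le _ _) _.
  apply: (@le_trans _ _ (`|e i| * (`|A - h^-1 *: (Lam tau - Lam sigma)| * `|e j|))).
    by rewrite ler_wpM2l// compact_op_le.
  rewrite ltr_pdivlMr// in hA.
  apply: le_trans (ltW hA); rewrite mulrCA.
  by rewrite ler_wpM2l// lerDl.
have -> : A = (A - h^-1 *: (Lam tau - Lam sigma)) + h^-1 *: (Lam tau - Lam sigma).
  by rewrite subrK.
rewrite compact_op_addE innerC innerDl ![inner _ (e i)]innerC.
rewrite (le_trans (ler_normD _ _))// [leRHS]splitr lerD//.
exact: ltW.
Unshelve. all: by end_near. Qed.
End NtD_differential.

(** * Real analytic charts *)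

Section multilinear_theory.
Context (R : realType) (V W : normedModType R) (j : nat) (G : ('I_j -> V) -> W).
Hypothesis mG : multilinear G.
Implicit Types (u v : 'I_j -> V) (c : 'I_j -> R).

Let subst (i : 'I_j) v z := fun k => if k == i then z else v k.

Let substP i v a x y :
  G (subst i v (a *: x + y)) = a *: G (subst i v x) + G (subst i v y).
Proof. exact: mG. Qed.

Lemma multilinear_subst0 i v : G (subst i v 0) = 0.
Proof.
by apply: addr_idem_eq0; have := substP i v 1 0 0; rewrite !scale1r addr0.
Qed.

Lemma multilinear_substZ i v a x : G (subst i v (a *: x)) = a *: G (subst i v x).
Proof.
by rewrite -[a *: x]addr0 substP multilinear_subst0 addr0.
Qed.

Lemma multilinear_substB i v x y :
  G (subst i v (x - y)) = G (subst i v x) - G (subst i v y).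
Proof. by rewrite addrC -scaleN1r substP scaleN1r addrC. Qed.

Lemma multilinearZ c u : G (fun i => c i *: u i) = (\prod_i c i) *: G u.
Proof.
(* The scalars are pulled out of the slots listed in s, one at a time. *)
have H (s : seq 'I_j) : uniq s ->
    G (fun i => if i \in s then c i *: u i else u i) = (\prod_(i <- s) c i) *: G u.
  elim: s => [_|i s IH /= /andP[ins us]].
    by rewrite big_nil scale1r.
  rewrite big_cons -scalerA -IH//.
  set v := fun k => if k \in s then c k *: u k else u k.
  have -> : v = subst i v (u i).
    by apply/funext => k; rewrite /subst /v; case: eqVneq => // ->; rewrite (negbTE ins).
  rewrite -multilinear_substZ; congr G; apply/funext => k.
  rewrite /subst in_cons; case: eqVneq => [->|_] //=.
rewrite -(H _ (index_enum_uniq _)); congr G.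
by apply/funext => i; rewrite mem_index_enum.
Qed.

Hypothesis fG : (multilinear_norm G < +oo)%E.

Lemma multilinear_norm_ge0 : (0 <= multilinear_norm G)%E.
Proof.
apply: ereal_sup_ge; exists `|G (fun=> 0)|%:E; last by rewrite lee_fin.
by exists (fun=> 0) => //= i; rewrite normr0.
Qed.

(** Dividing v_i by c_i gives a point of the unit ball. Positive bounds c_i instead of the norms of
    the v_i allow zero vectors. *)
Lemma multilinear_le v c : (forall i, 0 < c i) -> (forall i, `|v i| <= c i) ->
  `|G v| <= fine (multilinear_norm G) * \prod_i c i.
Proof.
move=> c0 vc.
have -> : v = fun i => c i *: ((c i)^-1 *: v i).
  by apply/funext => i; rewrite scalerA mulfV ?gt_eqF// scale1r.
rewrite multilinearZ normrZ mulrC ger0_norm; last by apply: prodr_ge0 => i _; exact: ltW.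
rewrite ler_wpM2r ?prodr_ge0// => [i _|]; first exact: ltW.
rewrite -lee_fin fineK ?ge0_fin_numE ?multilinear_norm_ge0//.
apply: ereal_sup_ubound; exists (fun i => (c i)^-1 *: v i) => //= i.
by rewrite normrZ normfV (gtr0_norm (c0 i)) ler_pdivrMl// mulr1.
Qed.

(** The argument k is replaced by h one slot at a time; each of the j steps has h - k in one slot
    and vectors of norm at most r in the others. *)
Lemma multilinear_diag_lipschitz (r : R) h k : 0 < r -> `|h| <= r -> `|k| <= r ->
  `|G (fun=> h) - G (fun=> k)| <=
  j%:R * fine (multilinear_norm G) * r ^+ j.-1 * `|h - k|.
Proof.
move=> r0 hr kr.
have [->|hk] := eqVneq h k; first by rewrite !subrr !normr0 mulr0.
pose v (i : nat) : 'I_j -> V := fun l => if (l < i)%N then h else k.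
have -> : G (fun=> h) - G (fun=> k) = \sum_(i < j) (G (v i.+1) - G (v i)).
  rewrite -(big_mkord xpredT (fun i => G (v i.+1) - G (v i))) telescope_sumr//.
  by congr (G _ - G _); apply/funext => l; rewrite /v ?ltn_ord.
apply: (le_trans (ler_norm_sum _ _ _)).
rewrite [leRHS](_ : _ =
  \sum_(i < j) (fine (multilinear_norm G) * r ^+ j.-1 * `|h - k|)); last first.
  by rewrite sumr_const card_ord -[RHS]mulr_natl; lra.
apply: ler_sum => i _.
have -> : G (v i.+1) - G (v i) = G (subst i (v i) (h - k)).
  rewrite multilinear_substB; congr (G _ - G _); apply/funext => l;
    rewrite /subst /v; case: eqVneq => [->|li]; rewrite ?ltnS ?leqnn ?ltnn//.
  by rewrite ltn_neqAle (inj_eq val_inj) li.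
pose c (l : 'I_j) := if l == i then `|h - k| else r.
have := @multilinear_le (subst i (v i) (h - k)) c.
have -> : \prod_l c l = `|h - k| * r ^+ j.-1.
  rewrite (bigD1 i)//= /c eqxx; congr (_ * _).
  rewrite (eq_bigr (fun=> r)); last by move=> l /negbTE ->.
  by rewrite prodr_const cardC1 card_ord.
rewrite -mulrA [X in _ * X]mulrC; apply.
- by move=> l; rewrite /c; case: ifP => // _; rewrite normr_gt0 subr_eq0.
- by move=> l; rewrite /c /subst /v; case: ifP => // _; case: ifP.
Qed.

End multilinear_theory.

(** Follows from r^(j-1) <= r (rho/2)^(j-2) and j <= 4 * 2^(j-2). The factor r left over makes the
    terms of degree at least 2 a remainder. *)
Lemma mulrn_half_exp_le (R : realType) (r rho : R) j : 0 < r -> r <= rho / 2 ->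
  (2 <= j)%N -> j%:R * r ^+ j.-1 <= r * (4 / rho ^+ 2) * rho ^+ j.
Proof.
move=> r0 rrho; case: j => [//|[//|j _]] /=.
have rho0 : 0 < rho by have := lt_le_trans r0 rrho; rewrite pmulr_lgt0.
rewrite exprS mulrCA -mulrA ler_pM2l//.
have -> : 4 / rho ^+ 2 * rho ^+ j.+2 = 4 * rho ^+ j.
  have -> : rho ^+ j.+2 = rho ^+ j * rho ^+ 2 by rewrite -exprD addn2.
  by rewrite mulrCA divfK 1?mulrC// gt_eqF// exprn_gt0.
apply: (@le_trans _ _ (j.+2%:R * (rho / 2) ^+ j)).
  by rewrite ler_wpM2l// lerXn2r// nnegrE ltW// (lt_le_trans r0).
rewrite expr_div_n mulrA ler_pdivrMr ?exprn_gt0// -[leRHS]mulrA [X in _ <= _ * X]mulrC mulrA.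
rewrite ler_wpM2r ?exprn_ge0 ?(ltW rho0)//.
have pow2_ge1 i : 1 <= 2 ^+ i :> R by rewrite exprn_ege1// ler1n.
elim: j => [|j IH]; first by rewrite expr0; lra.
by rewrite exprS -natr1; have := pow2_ge1 j; lra.
Qed.

Section analytic_strict_differentiability.
Context (R : realType) (V W : normedModType R).

(** L is the term of degree 1. In f (t + x) - f (t + y) the constant term cancels, and the terms of
    degree at least 2 have Lipschitz constants on the ball of radius s that sum to O(s). *)
Lemma analytic_expansion (U : set V) (f : V -> W) t : real_analytic U f -> U t ->
  exists r C (L : {linear V -> W}), [/\ 0 < r, 0 <= C, ball t r `<=` U &
    (forall x, `|L x| <= C * `|x|) /\
    forall s x y, 0 < s -> s <= r -> `|x| <= s -> `|y| <= s ->
      `|f (t + x) - f (t + y) - L (x - y)| <= C * s * `|x - y|].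
Proof.
move=> fU Ut; have [rho [G [rho0 rhoU Gj Gfin fG]]] := fU _ Ut.
have mG j : multilinear (G j) by have [] := Gj j.
pose a j := fine (multilinear_norm (G j)).
have rhoj j : 0 < rho ^+ j by rewrite exprn_gt0.
have term0 j : (0 <= multilinear_norm (G j) * (rho ^+ j)%:E)%E.
  by rewrite mule_ge0 ?lee_fin ?(ltW (rhoj j))//; exact: multilinear_norm_ge0.
have nfin j : (multilinear_norm (G j) < +oo)%E.
  have : (multilinear_norm (G j) * (rho ^+ j)%:E < +oo)%E.
    apply: le_lt_trans Gfin; apply: le_trans (nneseries_lim_ge j.+1 _) => //.
    by rewrite big_nat_recr//= leeDr// sume_ge0.
  move: (multilinear_norm_ge0 (G j)).
  case: (multilinear_norm (G j)) => [r _ _|_|//]; first by rewrite ltry.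
  by rewrite gt0_mulye ?lte_fin.
have aE j : (multilinear_norm (G j) = (a j)%:E).
  by rewrite /a fineK// ge0_fin_numE// multilinear_norm_ge0.
have a0 j : 0 <= a j by rewrite -lee_fin -aE multilinear_norm_ge0.
pose S := fine (\sum_(0 <= j <oo) (multilinear_norm (G j) * (rho ^+ j)%:E))%E.
have Sfin : (\sum_(0 <= j <oo) (multilinear_norm (G j) * (rho ^+ j)%:E) = S%:E)%E.
  by rewrite /S fineK// ge0_fin_numE// nneseries_ge0.
have S_ge n : \sum_(0 <= j < n) a j * rho ^+ j <= S.
  rewrite -lee_fin -Sfin -sumEFin.
  under eq_bigr do rewrite EFinM -aE.
  exact: nneseries_lim_ge.
have S0 : 0 <= S by have := S_ge 0; rewrite big_nil.
pose G1 h := G 1 (fun=> h).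
have linG1 : linear G1.
  move=> c x y; have := mG 1 ord0 (fun=> 0) c x y.
  have E z : (fun k : 'I_1 => if k == ord0 then z else 0) = (fun=> z) :> ('I_1 -> V).
    by apply/funext => k; rewrite ord1.
  by rewrite /= !E.
pose L : {linear V -> W} := HB.pack G1 (GRing.isLinear.Build _ _ _ _ G1 linG1).
have LE x : L x = G 1 (fun=> x) by [].
have Lle x : `|L x| <= a 1 * `|x|.
  have [->|x0] := eqVneq x 0; first by rewrite linear0 !normr0 mulr0.
  have := @multilinear_le _ _ _ _ _ (mG 1) (nfin 1) (fun=> x) (fun=> `|x|).
  rewrite big_ord1; apply => //= _; first by rewrite normr_gt0.
(* Radius rho / 2 is what [mulrn_half_exp_le] requires. The constant adds the bound of the remainder
   to that of L, so that it serves for both. *)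
exists (rho / 2), (4 / rho ^+ 2 * S + a 1), L; split.
- by rewrite divr_gt0.
- by rewrite addr_ge0// mulr_ge0// divr_ge0// exprn_ge0// ltW.
- by apply: subset_trans rhoU; apply: le_ball; rewrite ler_pdivrMr// ler_peMr ?ler1n// ltW.
split=> [x|s x y s0 srho xs ys].
  rewrite (le_trans (Lle x))// ler_wpM2r// lerDr mulr_ge0// divr_ge0//.
  by rewrite exprn_ge0// ltW.
apply: (@le_trans _ _ (4 / rho ^+ 2 * S * s * `|x - y|)); last first.
  by rewrite ler_wpM2r// ler_wpM2r ?(ltW s0)// lerDl.
have srho' : s < rho.
  by rewrite (le_lt_trans srho)// ltr_pdivrMr// ltr_pMr// ltr1n.
have cx := fG x (le_lt_trans xs srho').
have cy := fG y (le_lt_trans ys srho').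
have cxy : series (fun j => G j (fun=> x)) n - series (fun j => G j (fun=> y)) n - L (x - y)
    @[n --> \oo] --> f (t + x) - f (t + y) - L (x - y).
  by apply: cvgB; [exact: cvgB|exact: cvg_cst].
move/cvg_norm : cxy => /(_ _) cxy.
rewrite -(cvg_lim (@Rhausdorff R) cxy).
apply: limr_le; [exact: cvgP cxy|near=> n].
(* The partial sum must contain the term of degree 1, from which L is subtracted. *)
have n2 : (1 < n)%N by near: n; exact: nbhs_infty_gt.
pose D j := G j (fun=> x) - G j (fun=> y) - (j == 1)%:R *: L (x - y).
have -> : series (fun j => G j (fun=> x)) n - series (fun j => G j (fun=> y)) n - L (x - y)
   = \sum_(0 <= j < n) D j.
  rewrite /D !sumrB; congr (_ - _).
  rewrite big_mkord (bigD1 (Ordinal n2))//= scale1r big1 ?addr0// => j j1.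
  by rewrite (_ : (j == 1 :> nat) = false) ?scale0r//; apply/negbTE.
apply: (le_trans (ler_norm_sum _ _ _)).
have k0 : 0 <= 4 / rho ^+ 2 by rewrite divr_ge0// exprn_ge0// ltW.
apply: (@le_trans _ _
  (4 / rho ^+ 2 * s * `|x - y| * \sum_(0 <= j < n) a j * rho ^+ j)); last first.
  have -> : 4 / rho ^+ 2 * S * s * `|x - y| = 4 / rho ^+ 2 * s * `|x - y| * S.
    by rewrite (mulrAC _ S s) (mulrAC _ S).
  apply: ler_wpM2l; last exact: S_ge.
  by apply: mulr_ge0 => //; apply: mulr_ge0 => //; exact: ltW.
have D0 j : 0 <= 4 / rho ^+ 2 * s * `|x - y| * (a j * rho ^+ j).
  by rewrite !mulr_ge0 ?(ltW s0) ?a0 ?(ltW (rhoj _)) ?invr_ge0 ?sqr_ge0.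
rewrite mulr_sumr; apply: ler_sum => -[_|[_|j _]].
- rewrite /D (_ : (fun=> x) = (fun=> y)); last by apply/funext => -[].
  by rewrite subrr scale0r subrr normr0 D0.
- rewrite /D eqxx scale1r -!LE linearB subrr normr0; exact: D0.
rewrite /D scale0r subr0.
apply: (le_trans (multilinear_diag_lipschitz (mG j.+2) (nfin j.+2) s0 xs ys)).
have := mulrn_half_exp_le s0 srho (isT : (2 <= j.+2)%N).
move=> /(ler_wpM2r (mulr_ge0 (a0 j.+2) (normr_ge0 (x - y)))); rewrite /a; lra.
Unshelve. all: by end_near. Qed.
End analytic_strict_differentiability.

(** For y = 0 and s = |x| the remainder in [analytic_expansion] is O(|x|^2), which identifies L with
    the differential. *)
Lemma analytic_strictly_differentiable (R : realType) (V W : normedModType R)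
    (U : set V) (f : V -> W) t : real_analytic U f -> U t ->
  exists r C, [/\ 0 < r, 0 <= C, ball t r `<=` U,
    forall x, `|'d f t x| <= C * `|x| &
    forall s x y, 0 < s -> s <= r -> `|x| <= s -> `|y| <= s ->
      `|f (t + x) - f (t + y) - 'd f t (x - y)| <= C * s * `|x - y|].
Proof.
move=> fU Ut; have [r [C [L [r0 C0 rU [LC fL]]]]] := analytic_expansion fU Ut.
suff dL : 'd f t = L :> (V -> W) by exists r, C; split => //; rewrite dL.
apply: diff_unique.
  apply: bounded_linear_continuous; apply/linear_boundedP.
  exists C; split; first exact: num_real.
  by move=> c /ltW Cc x; rewrite (le_trans (LC x))// ler_wpM2r.
have C1 : 0 < C + 1 by rewrite ltr_wpDl.
apply/eqaddoP => eps eps0.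
have q0 : 0 < eps / (C + 1) by rewrite divr_gt0.
near=> x; rewrite /= !fctE/=.
have [->|x0] := eqVneq x 0; first by rewrite linear0 addr0 add0r subrr !normr0 mulr0.
have {}x0 : 0 < `|x| by rewrite normr_gt0.
have xr : `|x| <= r by near: x; exact: nbhs0_le.
have := fL `|x| x 0 x0 xr (lexx _); rewrite normr0 => /(_ (ltW x0)).
rewrite addr0 subr0 opprD addrA [x + t]addrC => /le_trans; apply.
rewrite ler_wpM2r//.
have xe : `|x| <= eps / (C + 1) by near: x; exact: nbhs0_le.
by rewrite ler_pdivlMr// in xe; lra.
Unshelve. all: by end_near. Qed.

(** Continuity of the inverse chart at phi t, together with openness of the image of the chart in
    M. *)
Lemma chart_near (R : realType) (X : normedModType R) d (M : set X) V
    (phi : 'rV[R]_d -> X) t r : is_chart M V phi -> V t -> 0 < r ->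
  exists2 delta, 0 < delta & forall s, M s -> `|s - phi t| < delta ->
    exists2 x, `|x| < r & phi (t + x) = s.
Proof.
move=> [_ _ _ [W oW VW] [psi [psiK _ /subspace_continuousP cpsi]]] Vt r0.
have VPt : (phi @` V) (phi t) by exists t.
have psit : psi (phi t) = t by rewrite psiK// inE.
have := cpsi _ VPt; rewrite /from_subspace psit => /cvgrPdist_lt /(_ _ r0).
rewrite near_withinE => H.
have Wt : W (phi t) by have : (phi @` V) (phi t) by []; rewrite VW => -[].
have {H} : \forall s \near phi t, W s /\ ((phi @` V) s -> `|t - psi s| < r).
  by apply: filterI => //; exact: open_nbhs_nbhs.
move=> /nbhs_normP[delta /= delta0 H]; exists delta => // s Ms sd.
have [Ws Hs] : W s /\ ((phi @` V) s -> `|t - psi s| < r).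
  by apply: H; rewrite /ball_/= distrC.
have Vs : (phi @` V) s by rewrite VW; split.
have := Hs Vs; have [u Vu us] := Vs.
have psiu : psi (phi u) = u by rewrite psiK// inE.
rewrite -us psiu => tu; exists (u - t); first by rewrite distrC.
by rewrite subrKC.
Qed.

Lemma rV_norm_coord (R : realType) n (x : 'rV[R]_n) i : `|x ord0 i| <= `|x|.
Proof.
rewrite [leRHS]/Num.Def.normr/= mx_normrE; apply/bigmax_geP; right => /=.
by exists (ord0, i).
Qed.

Lemma rV_norm_le (R : realType) n (x : 'rV[R]_n) c :
  0 <= c -> (forall i, `|x ord0 i| <= c) -> `|x| <= c.
Proof.
move=> c0 xc; rewrite [leLHS]/Num.Def.normr/= mx_normrE; apply/bigmax_leP; split => //=.
by move=> [i j] _ /=; rewrite ord1.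
Qed.

(** * Box dimension of compact subsets of a manifold *)

Section box_dimension.
Context (R : realType) (X : normedModType R) (d : nat).
Implicit Types A B K : set X.

(* The fibres of [c] are the cells of a partition of A. *)
Definition box_dimension_le A := exists C : nat, forall p : nat,
  exists (I : finType) (c : X -> I), (#|I| <= C * p.+1 ^ d)%N /\
    forall s s', A s -> A s' -> c s = c s' -> `|s - s'| <= C%:R / p.+1%:R.

Lemma box_dimension_le0 : box_dimension_le set0.
Proof.
exists 1 => p; exists unit, (fun=> tt); split => //.
by rewrite card_unit mul1n expn_gt0.
Qed.

Lemma box_dimension_leS A B : A `<=` B -> box_dimension_le B -> box_dimension_le A.
Proof.
move=> AB [C BC]; exists C => p; have [I [c [Ic cB]]] := BC p.
by exists I, c; split => // s s' /AB Bs /AB Bs'; exact: cB.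
Qed.

Lemma box_dimension_leU A B :
  box_dimension_le A -> box_dimension_le B -> box_dimension_le (A `|` B).
Proof.
move=> [C AC] [D BD]; exists (C + D)%N => p.
have [I [c [Ic cA]]] := AC p; have [J [c' [Jc cB]]] := BD p.
exists (I + J)%type, (fun s => if `[< A s >] then inl (c s) else inr (c' s)).
split; first by rewrite card_sum mulnDl leq_add.
move=> s s' ABs ABs'; case: asboolP => As; case: asboolP => As' // [] ss'.
  by rewrite (le_trans (cA _ _ As As' ss'))// ler_pM2r ?invr_gt0// ler_nat leq_addr.
have Bs : B s by case: ABs.
have Bs' : B s' by case: ABs'.
by rewrite (le_trans (cB _ _ Bs Bs' ss'))// ler_pM2r ?invr_gt0// ler_nat leq_addl.
Qed.

(** The cube of half-side r around 0 is cut into (p + 1)^d boxes of side 2 r / (p + 1), pulled back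
    by xi to cells of A. *)
Lemma box_dimension_le_image A (xi : X -> 'rV[R]_d) (r L : R) : 0 < r -> 0 <= L ->
  (forall s, A s -> `|xi s| < r) ->
  (forall s s', A s -> A s' -> `|s - s'| <= L * `|xi s - xi s'|) ->
  box_dimension_le A.
Proof.
move=> r0 L0 xir xiL; exists (Num.truncn (L * (2 * r))).+1 => p.
(* The i-th coordinate rescaled to [0, p + 1); its integer part is the index of the box. *)
pose q s i := p.+1%:R * (xi s ord0 i + r) / (2 * r).
have r20 : 0 < 2 * r by rewrite mulr_gt0.
have qlt s i : A s -> 0 <= q s i < p.+1%:R.
  move=> As; have := le_lt_trans (rV_norm_coord (xi s) i) (xir _ As).
  rewrite ltr_norml => /andP[l1 l2]; rewrite /q divr_ge0 ?mulr_ge0//=; last 2 first.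
  - by lra.
  - exact: ltW.
  by rewrite ltr_pdivrMr// ltr_pM2l//; lra.
exists {ffun 'I_d -> 'I_p.+1}, (fun s => [ffun i => inord (Num.truncn (q s i))]).
split; first by rewrite card_ffun !card_ord leq_pmull.
move=> s s' As As' /ffunP cs; rewrite (le_trans (xiL _ _ As As'))//.
apply: (@le_trans _ _ (L * (2 * r / p.+1%:R))).
  rewrite ler_wpM2l//; apply: rV_norm_le; first by rewrite divr_ge0// ltW.
  move=> i; have := cs i; rewrite !ffunE => /(congr1 val) /=.
  have /andP[q0 qp] := qlt s i As; have /andP[q0' qp'] := qlt s' i As'.
  rewrite !inordK ?truncn_lt_nat// => tt.
  have /andP[t1 t2] := truncn_itv q0; have /andP[t3 t4] := truncn_itv q0'.
  rewrite -tt in t3 t4; rewrite -natr1 in t2 t4.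
  have : `|q s i - q s' i| <= 1 by rewrite ler_norml; lra.
  have -> : q s i - q s' i = p.+1%:R / (2 * r) * (xi s - xi s') ord0 i.
    by rewrite /q !mxE -mulrBl -mulrBr opprD addrACA subrr addr0 mulrAC.
  by rewrite normrM gtr0_norm ?divr_gt0// -ler_pdivlMl ?divr_gt0// invf_div mulr1.
rewrite mulrA ler_pM2r ?invr_gt0//.
by have := truncnS_gt (L * (2 * r)); exact: ltW.
Qed.

(** Near each point, xi inverts a chart up to the translation by t. The chart is Lipschitz there
    with constant C r + C: remainder at scale r plus differential. *)
Lemma box_dimension_le_manifold (M K : set X) :
  analytic_manifold d M -> compact K -> K `<=` M -> box_dimension_le K.
Proof.
move=> Mman cK KM; apply: (compact_set_ideal cK).
- exact: box_dimension_le0.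
- exact: box_dimension_leU.
- exact: box_dimension_leS.
move=> a Ka; have [V [phi [chart [t Vt ta]]]] := Mman _ (KM _ Ka).
have [_ anphi _ _ _] := chart.
have [r [C [r0 C0 rV dphi phiE]]] := analytic_strictly_differentiable anphi Vt.
have [delta delta0 near_chart] := chart_near chart Vt r0.
exists (ball a delta); first exact: nbhsx_ballx.
pose xi s := get [set x | `|x| < r /\ phi (t + x) = s].
have xiP s : (K `&` ball a delta) s -> `|xi s| < r /\ phi (t + xi s) = s.
  move=> [Ks]; rewrite -ball_normE/= distrC -ta => sd.
  have [x xr xs] := near_chart _ (KM _ Ks) sd.
  by apply: (@getI _ [set x | `|x| < r /\ phi (t + x) = s] x).
apply: (@box_dimension_le_image _ xi r (C * r + C)) => //.
- by rewrite addr_ge0// mulr_ge0// ltW.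
- by move=> s /xiP[].
move=> s s' /xiP[xr xs] /xiP[xr' xs'].
rewrite -{1}xs -{1}xs' mulrDl.
have := phiE r _ _ r0 (lexx _) (ltW xr) (ltW xr').
set D := 'd phi t _ => H.
rewrite -[X in `|X|](subrK D) (le_trans (ler_normD _ _))// lerD//.
exact: dphi.
Qed.

End box_dimension.

(** * Separation by finitely many matrix coefficients *)

Section NtD_separation.
Context d (T : measurableType d) (R : realType) (mu : {measure set T -> \bar R}).
Context d' (T' : measurableType d') (nu : {measure set T' -> \bar R}) (m : nat).
Local Notation Linf := (Linfty mu).
Local Notation L2b := (L2mean0 nu).
Variables (Lam : Linf -> compact_op L2b L2b) (Gr : Linf -> L2b -> 'I_m -> L2 mu).
Hypothesis GrE : forall sigma tau f g, elliptic sigma -> elliptic tau ->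
  form sigma (Gr sigma f) (Gr tau g) = inner f (Lam tau g).
Implicit Types (sigma tau : Linf).

(** The difference is a form with weight sigma - tau, which tends to the weight 0. *)
Lemma inner_NtD_continuous sigma f g eps : elliptic sigma -> 0 < eps ->
  exists2 delta, 0 < delta & forall tau, `|tau - sigma| < delta ->
    `|inner f (Lam tau g) - inner f (Lam sigma g)| < eps.
Proof.
move=> s0 eps0.
have [delta d0 dP] := form_gradient_continuous GrE 0 f g s0 eps0.
have [l l0 lP] := elliptic_near s0.
exists (Num.min delta l); first by rewrite lt_min d0.
move=> tau; rewrite lt_min => /andP[td tl]; have [_ t0] := lP _ tl.
rewrite (inner_NtDB GrE)//.
have H : `|sigma - tau - 0| < delta by rewrite subr0 distrC.
have s1 : `|sigma - sigma| < delta by rewrite subrr normr0.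
by have := dP _ _ _ s1 td H; rewrite Linfty_form0 subr0.
Qed.

Variables (e : nat -> L2b) (n : nat) (M : set Linf).
Hypotheses (he : orthonormal_basis e) (hM : analytic_manifold n M).

Definition separated N sigma tau := exists i j, [/\ (i < N)%N, (j < N)%N &
  inner (e i) (Lam sigma (e j)) <> inner (e i) (Lam tau (e j))].

Lemma separatedS N N' sigma tau : (N <= N')%N -> separated N sigma tau ->
  separated N' sigma tau.
Proof.
by move=> NN' [i [j [iN jN ij]]]; exists i, j; split => //; exact: leq_trans NN'.
Qed.

(** Some coefficient differs by c at (sigma, tau), and varies by less than |c| / 2 at each of the
    two points. *)
Lemma separated_neq sigma tau : elliptic sigma -> elliptic tau ->
  Lam sigma <> Lam tau -> exists N delta, 0 < delta /\
    forall sigma' tau', `|sigma' - sigma| < delta -> `|tau' - tau| < delta ->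
      separated N sigma' tau'.
Proof.
move=> s0 t0 st.
have [i [j ij]] : exists i j, inner (e i) ((Lam sigma - Lam tau) (e j)) <> 0.
  apply: contrapT => H; apply: st; apply/eqP; rewrite -subr_eq0; apply/eqP.
  apply: (compact_op_separated he) => i j; apply: contrapT => ij.
  by apply: H; exists i, j.
rewrite innerC innerBl ![inner _ (e i)]innerC in ij.
set c := _ - _ in ij.
have c0 : 0 < `|c| / 2 by rewrite divr_gt0// normr_gt0; apply/eqP.
have [d1 d10 H1] := inner_NtD_continuous (e i) (e j) s0 c0.
have [d2 d20 H2] := inner_NtD_continuous (e i) (e j) t0 c0.
exists (maxn i j).+1, (Num.min d1 d2); split; first by rewrite lt_min d10.
move=> s' t'; rewrite !lt_min => /andP[/H1 h1 _] /andP[_ /H2 h2].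
exists i, j; rewrite !ltnS leq_maxl leq_maxr; split => // E.
rewrite E distrC in h1.
have : `|c| < `|c|.
  by rewrite [ltRHS]splitr (le_lt_trans _ (ltrD h1 h2))// ler_distD.
by rewrite ltxx.
Qed.

(** Two points phi (t + x), phi (t + y) near sigma differ by about |x - y| times ['d phi t v], with
    v the direction of x - y. By injectivity of both differentials some coefficient of the form with
    this weight is nonzero; compactness of the sphere of directions makes the choice uniform. *)
Lemma separated_diag (sigma : Linf) : elliptic sigma -> M sigma ->
  {in tangent_space n M sigma &, injective ('d Lam sigma)} ->
  exists N delta, 0 < delta /\ forall sigma' tau', elliptic sigma' -> elliptic tau' ->
    M sigma' -> M tau' -> `|sigma' - sigma| < delta -> `|tau' - sigma| < delta ->
    sigma' <> tau' -> separated N sigma' tau'.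
Proof.
move=> s0 Ms dinj; have [V [phi [chart [t Vt ts]]]] := hM Ms.
have [_ anphi phi_inj _ _] := chart.
have [r [C [r0 C0 rV dphi phiE]]] := analytic_strictly_differentiable anphi Vt.
have dphi_neq0 v : v != 0 -> 'd Lam sigma ('d phi t v) <> 0.
  move=> v0 L0; have : 'd phi t v = 'd phi t 0.
    apply: dinj; rewrite ?inE.
    - by exists V, phi, t, v.
    - by exists V, phi, t, 0.
    - by rewrite L0 !linear0.
  by move=> /(phi_inj t Vt) /eqP; rewrite (negbTE v0).
pose S := [set v : 'rV[R]_n | `|v| = 1].
have cS : compact S.
  apply: bounded_closed_compact.
    exists 1; split; first exact: num_real.
    by move=> x x1 v /= ->; exact: ltW.
  have -> : S = (fun v : 'rV[R]_n => `|v|) @^-1` [set 1] by [].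
  apply: closed_comp => [v _|]; first exact: norm_continuous.
  exact: closed_eq.
(* N is both the number of basis vectors and, through 1 / (N + 1), the size of the neighbourhood, so
   that one compactness argument fixes the two. *)
pose P (N : nat) (v : 'rV[R]_n) := forall x y, `|x| < N.+1%:R^-1 ->
  `|y| < N.+1%:R^-1 -> x != y -> x - y = `|x - y| *: v ->
  elliptic (phi (t + x)) -> elliptic (phi (t + y)) ->
  separated N (phi (t + x)) (phi (t + y)).
have PS v0 : S v0 -> \forall v \near v0 & N \near \oo, P N v.
  move=> v01; have v00 : v0 != 0 by rewrite -normr_gt0 v01.
  have [i [j ij]] : exists i j,
      form ('d phi t v0 : Linf) (Gr sigma (e i)) (Gr sigma (e j)) <> 0.
    apply: contrapT => H; apply: (dphi_neq0 _ v00).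
    apply: (differential_NtD_eq0 GrE he s0) => i j.
    by apply: contrapT => ij; apply: H; exists i, j.
  move/eqP : ij; rewrite -normr_gt0 => c0.
  have [delta d0 dP] := form_gradient_continuous GrE ('d phi t v0) (e i) (e j) s0 c0.
  have C1 : 0 < C * r + C + 1 by rewrite ltr_wpDl// addr_ge0// mulr_ge0// ltW.
  (* This radius q satisfies (C r + C) q < delta / 2, which keeps phi (t + x) and phi (t + y) within
     delta of sigma and the difference quotient within delta of ['d phi t v0]. *)
  have q0 : 0 < delta / 2 / (C * r + C + 1) by rewrite !divr_gt0.
  exists (ball v0 (delta / 2 / (C * r + C + 1)),
    [set N | (maxn i j < N)%N /\ N.+1%:R^-1 < Num.min r (delta / 2 / (C * r + C + 1))]).
    split; first exact: nbhsx_ballx.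
    apply: filterI; first exact: nbhs_infty_gt.
    have m0 : 0 < Num.min r (delta / 2 / (C * r + C + 1)) by rewrite lt_min r0.
    exact: (near_infty_natSinv_lt (PosNum m0)).
  move=> [v N] /= [v0v [ijN]]; rewrite lt_min => /andP[Nr Nq].
  move=> x y xN yN xy xyv ex ey.
  have Dxy : 0 < `|x - y| by rewrite normr_gt0 subr_eq0.
  pose s : R := N.+1%:R^-1.
  have ss0 : 0 < s by rewrite invr_gt0.
  have qE : delta / 2 / (C * r + C + 1) * (C * r + C + 1) = delta / 2.
    by rewrite divfK// gt_eqF.
  set q := delta / 2 / (C * r + C + 1) in q0 v0v Nq qE.
  have Cq : (C * r + C) * q < delta / 2 by rewrite -qE [ltRHS]mulrC ltr_pM2r// ltrDl.
  have Cq' : C * q <= (C * r + C) * q.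
    by rewrite ler_pM2r// lerDr mulr_ge0// ltW.
  have lip z : `|z| < s -> `|phi (t + z) - sigma| < delta.
    move=> zs; rewrite -ts -[X in _ - phi X]addr0.
    have zr : `|z| <= r by rewrite ltW// (lt_trans zs).
    have := phiE r z 0 r0 (lexx _) zr; rewrite normr0 subr0 => /(_ (ltW r0)) H.
    have := dphi z; have := ler_normD (phi (t + z) - phi (t + 0) - 'd phi t z) ('d phi t z).
    rewrite subrK => H1 H2.
    apply: (@le_lt_trans _ _ ((C * r + C) * `|z|)); first lra.
    have : (C * r + C) * `|z| <= (C * r + C) * q.
      rewrite ler_wpM2l ?addr_ge0 ?mulr_ge0// ?(ltW r0)//.
      by rewrite ltW// (lt_trans zs).
    lra.
  exists i, j; split.
  - by rewrite (leq_ltn_trans _ ijN)// leq_maxl.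
  - by rewrite (leq_ltn_trans _ ijN)// leq_maxr.
  move=> E.
  (* Equal coefficients would make the form with the difference quotient as weight vanish, although
     it is closer to the nonzero limit than that limit is to 0. *)
  have := inner_NtDB GrE (e i) (e j) ex ey; rewrite E subrr => F0.
  have := dP _ _ (`|x - y|^-1 *: (phi (t + x) - phi (t + y))) (lip _ xN) (lip _ yN).
  rewrite Linfty_formZl -F0 mulr0 sub0r normrN ltxx => H.
  have /H// : `|(`|x - y|^-1 *: (phi (t + x) - phi (t + y)) : Linf) - 'd phi t v0| < delta.
  have -> : `|x - y|^-1 *: (phi (t + x) - phi (t + y)) - 'd phi t v0 =
     `|x - y|^-1 *: (phi (t + x) - phi (t + y) - 'd phi t (x - y)) + 'd phi t (v - v0).
    have -> : 'd phi t (x - y) = `|x - y| *: 'd phi t v by rewrite {1}xyv linearZ.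
    rewrite [in RHS]scalerBr scalerA mulVf ?gt_eqF// scale1r ['d phi t (v - v0)]linearB.
    by rewrite addrA subrK.
  rewrite (le_lt_trans (ler_normD _ _))// normrZ normfV normr_id.
  have H1 : `|x - y|^-1 * `|phi (t + x) - phi (t + y) - 'd phi t (x - y)| <= C * q.
    rewrite ler_pdivrMl// [leRHS]mulrC.
    rewrite (le_trans (phiE s x y ss0 (ltW Nr) (ltW xN) (ltW yN)))//.
    by rewrite ler_wpM2r// ler_wpM2l// ltW.
  have H2 : `|'d phi t (v - v0)| <= C * q.
    rewrite (le_trans (dphi _))// ler_wpM2l// distrC ltW//.
    by move: v0v; rewrite -ball_normE.
  lra.
move/compact_near_coveringP : cS => /(_ nat \oo P _ PS) [N0 _ /(_ _ (leqnn N0)) PN0].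
have NN : 0 < N0.+1%:R^-1 :> R by rewrite invr_gt0.
have [delta d0 near_chart] := chart_near chart Vt NN.
exists N0, delta; split => // s1 s2 es1 es2 Ms1 Ms2.
rewrite -ts => /(near_chart _ Ms1)[x xN xs1] /(near_chart _ Ms2)[y yN ys2].
rewrite -xs1 -ys2 in es1 es2 * => xy.
have xy' : x != y by apply/eqP => xy'; apply: xy; rewrite xy'.
have Dxy : 0 < `|x - y| by rewrite normr_gt0 subr_eq0.
apply: (PN0 (`|x - y|^-1 *: (x - y))) => //.
- by rewrite /S/= normrZ normfV normr_id mulVf// gt_eqF.
- by rewrite scalerA mulfV ?scale1r// gt_eqF.
Qed.

(** [separated_diag] and [separated_neq] give a local N around each point of K x K; compactness
    makes it uniform because separation persists for larger N. *)
Lemma separated_uniform (K : set Linf) : compact K -> K `<=` @elliptic _ T R mu `&` M ->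
  {in K &, injective Lam} ->
  (forall sigma, K sigma ->
    {in tangent_space n M sigma &, injective ('d Lam sigma)}) ->
  exists N, forall sigma tau, K sigma -> K tau -> sigma <> tau ->
    separated N sigma tau.
Proof.
move=> cK KM Linj dinj.
pose P (N : nat) (p : Linf * Linf) :=
  K p.1 -> K p.2 -> p.1 <> p.2 -> separated N p.1 p.2.
have near2 (a b : Linf) N delta : 0 < delta ->
    (forall sigma tau, K sigma -> K tau -> `|sigma - a| < delta ->
      `|tau - b| < delta -> sigma <> tau -> separated N sigma tau) ->
    \forall p \near (a, b) & N \near \oo, P N p.
  move=> d0 H; exists ([set p : Linf * Linf | `|p.1 - a| < delta /\ `|p.2 - b| < delta],
      [set N' | (N <= N')%N]).
    split; last exact: nbhs_infty_ge.
    exists (ball a delta, ball b delta); first by split; exact: nbhsx_ballx.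
    by move=> [x y] [/=]; rewrite -!ball_normE/= ![`|_ - x|]distrC ![`|_ - y|]distrC.
  move=> [[s1 s2] N'] [/= [s1a s2b] NN'] K1 K2 s12.
  by apply: (separatedS NN'); exact: H.
have PK (p : Linf * Linf) : (K `*` K) p -> \forall p' \near p & N \near \oo, P N p'.
  case: p => a b [/= Ka Kb]; have [ea Ma] := KM _ Ka; have [eb Mb] := KM _ Kb.
  have [<-|ab] := pselect (a = b).
    have [N [delta [d0 H]]] := separated_diag ea Ma (dinj _ Ka).
    apply: (near2 a a N delta d0) => s1 s2 K1 K2 s1a s2a s12.
    by have [? ?] := KM _ K1; have [? ?] := KM _ K2; exact: H.
  have [N [delta [d0 H]]] : exists N delta, 0 < delta /\
    forall sigma' tau', `|sigma' - a| < delta -> `|tau' - b| < delta ->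
      separated N sigma' tau'.
    by apply: separated_neq => // /Linj; rewrite !inE => /(_ Ka Kb).
  by apply: (near2 a b N delta d0) => s1 s2 _ _ s1a s2b _; exact: H.
have := compact_setX cK cK.
move/compact_near_coveringP => /(_ nat \oo P _ PK) [N0 _ /(_ _ (leqnn N0)) PN0].
by exists N0 => s1 s2 K1 K2 s12; exact: (PN0 (s1, s2)).
Qed.

(** The energies of the fields are locally bounded, hence bounded on K, and enter the identity
    [inner_NtDB] with weight sigma - tau. *)
Lemma inner_NtD_lipschitz (K : set Linf) f g : compact K -> K `<=` @elliptic _ T R mu ->
  exists2 L, 0 <= L & forall sigma tau, K sigma -> K tau ->
    `|inner f (Lam sigma g) - inner f (Lam tau g)| <= L * `|sigma - tau|.
Proof.
move=> cK Ke.
have energy_bounded h : exists2 L, 0 <= L & forall sigma, K sigma -> energy (Gr sigma h) <= L.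
  apply: (@compact_set_ideal _ K (fun A =>
    exists2 L, 0 <= L & forall sigma, A sigma -> energy (Gr sigma h) <= L)) => //.
  - by exists 0.
  - move=> A B [c1 c10 hA] [c2 c20 hB]; exists (c1 + c2); first exact: addr_ge0.
    move=> s [/hA sL|/hB sL]; rewrite (le_trans sL)//; first by rewrite lerDl.
    by rewrite lerDr.
  - by move=> A B AB [L L0 hB]; exists L => // s /AB; exact: hB.
  move=> s /Ke es; have [l l0 H] := energy_gradient_bounded GrE h es.
  exists (ball s l); first exact: nbhsx_ballx.
  exists (4 * energy (Gr s h)); first by rewrite mulr_ge0// energy_ge0.
  by move=> t [_]; rewrite -ball_normE/= distrC; exact: H.
have [c1 c10 H1] := energy_bounded f; have [c2 c20 H2] := energy_bounded g.
exists (c1 + c2); first exact: addr_ge0.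
move=> s t Ks Kt; rewrite distrC (inner_NtDB GrE); last 2 first.
  exact: Ke.
  exact: Ke.
have := Linfty_form_le (s - t) (Gr s f) (Gr t g).
have : `|s - t| * (energy (Gr s f) + energy (Gr t g)) <= `|s - t| * (c1 + c2).
  by rewrite ler_wpM2l// lerD ?H1 ?H2.
have : 0 <= `|s - t| * (c1 + c2) by rewrite mulr_ge0// addr_ge0.
lra.
Qed.

End NtD_separation.

(** * Random measurements *)

Section product_measure_bounds.
Context d1 d2 (T1 : measurableType d1) (T2 : measurableType d2) (R : realType).
Local Open Scope ereal_scope.

(** The sections of A have measure at most k over B and are empty elsewhere; integrate over the
    first variable. *)
Lemma product_measure_le_xsection (m1 : {measure set T1 -> \bar R})
    (m2 : {sigma_finite_measure set T2 -> \bar R}) (A : set (T1 * T2)) B k :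
  measurable A -> measurable B -> 0 <= k -> (forall x y, A (x, y) -> B x) ->
  (forall x, B x -> m2 (xsection A x) <= k) ->
  (m1 \x m2) A <= k * m1 B.
Proof.
move=> mA mB k0 AB Ak; rewrite -integral_cst// [leRHS]integral_mkcond.
apply: ge0_le_integral => //.
- exact: measurable_fun_xsection.
- by apply/(measurable_restrictT _ _).1 => //; exact: measurable_cst.
move=> x _; rewrite patchE; case: ifPn => [/set_mem/Ak//|/negP nBx].
rewrite /= (_ : xsection A x = set0) ?measure0//.
by apply/seteqP; split => // y /xsectionP /AB /mem_set.
Qed.

Lemma product_measure_le_ysection (m1 : {sigma_finite_measure set T1 -> \bar R})
    (m2 : {sigma_finite_measure set T2 -> \bar R}) (A : set (T1 * T2)) B k :
  measurable A -> measurable B -> 0 <= k -> (forall x y, A (x, y) -> B y) ->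
  (forall y, B y -> m1 (ysection A y) <= k) ->
  (m1 \x m2) A <= k * m2 B.
Proof.
move=> mA mB k0 AB Ak.
(* By uniqueness the product measure may be computed by integrating in the other order. *)
rewrite (product_measure_unique (m' := (m1 \x^ m2)))//; last first.
  by move=> *; exact: product_measure2E.
rewrite -integral_cst// [leRHS]integral_mkcond.
apply: ge0_le_integral => //.
- exact: measurable_fun_ysection.
- by apply/(measurable_restrictT _ _).1 => //; exact: measurable_cst.
move=> x _; rewrite patchE; case: ifPn => [/set_mem/Ak//|/negP nBx].
rewrite /= (_ : ysection A x = set0) ?measure0//.
by apply/seteqP; split => // y /ysectionP /AB /mem_set.
Qed.

End product_measure_bounds.

(** * Lebesgue measure of slabs *)

Section slab.
Context (R : realType).

Definition cube n (r : R) : set 'rV[R]_n := [set z | forall i, `|z ord0 i| <= r].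

Lemma measurable_dotp n (a : 'rV[R]_n) :
  measurable_fun setT (fun z => dotp a z : measurableTypeR R).
Proof.
apply: measurable_sum => i; apply: measurable_funM => //.
exact: measurable_coord.
Qed.

Lemma measurable_cube n r : measurable (@cube n r).
Proof.
rewrite (_ : cube r =
  \bigcap_(i in [set: 'I_n]) (fun z : 'rV[R]_n => z ord0 i) @^-1` `[- r, r]).
  apply: fin_bigcap_measurable => // i _.
  by rewrite -[X in measurable X]setTI; exact: measurable_coord.
apply/seteqP; split => z; first by move=> cz i _ /=; rewrite in_itv/= -ler_norml.
by move=> cz i; rewrite ler_norml; have := cz i I; rewrite /= in_itv.
Qed.

(** The offset c absorbs the coordinates that are frozen in the induction on n. *)
Definition slab n (a : 'rV[R]_n) (c eps : R) : set 'rV[R]_n :=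
  [set z | `|dotp a z + c| <= eps].

Lemma measurable_slab n (a : 'rV[R]_n) c eps : measurable (slab a c eps).
Proof.
rewrite (_ : slab a c eps = (fun z => dotp a z + c) @^-1` `[- eps, eps]).
  rewrite -[X in measurable X]setTI.
  have mf : measurable_fun setT (fun z : 'rV[R]_n => dotp a z + c).
    exact: measurable_funD (measurable_dotp a) (measurable_cst c).
  exact: (mf measurableT _ (measurable_itv _)).
by apply/seteqP; split => z; rewrite /slab /= in_itv/= -ler_norml.
Qed.

Lemma lebesgue_rVS n (A : set 'rV[R]_n.+1) :
  lebesgue_rV n.+1 A = (@lebesgue_measure R \x lebesgue_rV n)%E (@rV_cons R n @^-1` A).
Proof. by []. Qed.

Lemma rV_cons0 n (p : R * 'rV[R]_n) : rV_cons p ord0 ord0 = p.1.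
Proof. by rewrite mxE unlift_none. Qed.

Lemma rV_consS n (p : R * 'rV[R]_n) i : rV_cons p ord0 (lift ord0 i) = p.2 ord0 i.
Proof. by rewrite mxE liftK. Qed.

Lemma cube_cons n r (p : R * 'rV[R]_n) :
  cube r (rV_cons p) <-> `|p.1| <= r /\ cube r p.2.
Proof.
split=> [cp|[p1 p2] i].
  split; first by have := cp ord0; rewrite rV_cons0.
  by move=> i; have := cp (lift ord0 i); rewrite rV_consS.
by case: (unliftP ord0 i) => [j ->|->]; rewrite ?rV_cons0// rV_consS.
Qed.

Lemma dotp_cons n (a : 'rV[R]_n.+1) (p : R * 'rV[R]_n) :
  dotp a (rV_cons p) = a ord0 ord0 * p.1 + dotp (\row_i a ord0 (lift ord0 i)) p.2.
Proof.
rewrite /dotp big_ord_recl rV_cons0; congr (_ + _).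
by apply: eq_bigr => i _; rewrite rV_consS mxE.
Qed.

Lemma lebesgue_interval_le (a b : R) : a <= b ->
  lebesgue_measure `[a, b] = (b - a)%:E.
Proof.
rewrite lebesgue_measure_itv/= lte_fin le_eqVlt => /predU1P[->|->//].
by rewrite ltxx subrr.
Qed.

Lemma lebesgue_cube n r : 0 <= r -> (lebesgue_rV n (cube r) <= ((2 * r) ^+ n)%:E)%E.
Proof.
move=> r0; elim: n => [|n IH].
  by rewrite expr0 /= /dirac indicE lee_fin; case: (_ \in _).
rewrite lebesgue_rVS (_ : _ @^-1` _ = `[- r, r]%classic `*` cube r); last first.
  apply/seteqP; split => p /=.
    by move=> /cube_cons[p1 p2]; split => //; rewrite in_itv/= -ler_norml.
  by move=> [/= p1 p2]; apply/cube_cons; split => //; rewrite ler_norml; rewrite in_itv in p1.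
rewrite product_measure1E//; last exact: measurable_cube.
have rr : - r <= r by lra.
rewrite exprS EFinM lee_pmul//.
by rewrite [leLHS](lebesgue_interval_le rr) lee_fin; lra.
Qed.

(** If the large entry of a is not the first, freezing the first coordinate reduces n. If it is,
    freezing the other coordinates confines the first one to an interval of length 2 eps / delta. *)
Lemma lebesgue_slab n r delta eps c (a : 'rV[R]_n) j : 0 <= r -> 0 < delta ->
  0 <= eps -> delta <= `|a ord0 j| ->
  (lebesgue_rV n (cube r `&` slab a c eps) <=
   ((2 * r) ^+ n.-1 * (2 * eps / delta))%:E)%E.
Proof.
move=> r0 d0 e0; have ed0 : 0 <= 2 * eps / delta by rewrite divr_ge0 ?mulr_ge0// ltW.
elim: n a j c => [|n IH] a j c aj; first by case: j {aj}.
rewrite lebesgue_rVS; set A := _ @^-1` _.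
have mA : measurable A.
  rewrite -[X in measurable X]setTI; apply: measurable_rV_cons => //.
  by apply: measurableI; [exact: measurable_cube|exact: measurable_slab].
pose a' := \row_i a ord0 (lift ord0 i).
have AE x z : A (x, z) <->
    (`|x| <= r /\ cube r z) /\ `|a ord0 ord0 * x + dotp a' z + c| <= eps.
  rewrite /A /slab /=; split => [[/cube_cons xz]|[xz axz]].
    by rewrite dotp_cons.
  by split; [exact/cube_cons|rewrite /= dotp_cons].
case: (unliftP ord0 j) aj => [j' ->|->] aj.
  rewrite (@le_trans _ _ (((2 * r) ^+ n.-1 * (2 * eps / delta))%:E * (2 * r)%:E)%E)//.
    have -> : (2 * r)%:E = @lebesgue_measure R `[- r, r].
      by rewrite lebesgue_interval_le; [congr EFin; lra|lra].
    apply: product_measure_le_xsection => //.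
    - by rewrite lee_fin mulr_ge0// exprn_ge0// mulr_ge0.
    - by move=> x z /AE[[xr _] _]; rewrite /= in_itv/= -ler_norml.
    move=> x _; apply: le_trans (IH a' j' (a ord0 ord0 * x + c) _); last by rewrite mxE.
    apply: le_measure; rewrite ?inE.
    - exact: measurable_xsection.
    - by apply: measurableI; [exact: measurable_cube|exact: measurable_slab].
    move=> z /xsectionP/AE[[_ zr] axz]; split => //.
    by rewrite /slab/= addrA [dotp _ _ + _]addrC.
  by rewrite -EFinM lee_fin mulrAC -exprSr prednK// (leq_ltn_trans _ (ltn_ord j')).
rewrite (@le_trans _ _ ((2 * eps / delta)%:E * ((2 * r) ^+ n)%:E)%E)//; last first.
  by rewrite -EFinM mulrC.
apply: (@le_trans _ _ ((2 * eps / delta)%:E * lebesgue_rV n (cube r))%E); last first.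
  by rewrite lee_wpmul2l ?lebesgue_cube.
apply: product_measure_le_ysection => //; first exact: measurable_cube.
  by move=> x z /AE[[]].
move=> z _.
have a0 : 0 < `|a ord0 ord0| by apply: lt_le_trans aj.
set k := (- (dotp a' z + c)) / a ord0 ord0.
apply: (@le_trans _ _ (@lebesgue_measure R `[k - eps / delta, k + eps / delta])).
  apply: le_measure; rewrite ?inE//; first exact: measurable_ysection.
  move=> x /ysectionP/AE[_ axz]; rewrite /= in_itv/= -ler_distlC distrC.
  rewrite ler_pdivlMr//; apply: le_trans axz.
  apply: (@le_trans _ _ (`|x - k| * `|a ord0 ord0|)); first by rewrite ler_wpM2l.
  rewrite -normrM mulrBl /k divfK ?opprK -?normr_gt0//.
  by rewrite addrA [x * _]mulrC.
have ed : 0 <= eps / delta by rewrite divr_ge0// ltW.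
have kk : k - eps / delta <= k + eps / delta by lra.
by rewrite [leLHS](lebesgue_interval_le kk) lee_fin; lra.
Qed.

End slab.

(** * Exhaustion by sets of bounded density *)

(** E_k is the set where the Radon-Nikodym density is at most k; these sets exhaust the space
    because the density is finite everywhere. *)
Lemma density_truncation d (T : measurableType d) (R : realType)
    (mu : {sigma_finite_measure set T -> \bar R})
    (nu : {finite_measure set T -> \bar R}) : nu `<< mu ->
  exists E : nat -> set T, [/\ forall k, measurable (E k),
    forall k l, (k <= l)%N -> E k `<=` E l, \bigcup_k E k = setT &
    forall k A, measurable A -> A `<=` E k -> (nu A <= k%:R%:E * mu A)%E].
Proof.
move=> /radon_nikodym_sigma_finite[f [f0 ffin intf nuE]].
have mf : measurable_fun setT f by have /integrableP[] := intf.
exists (fun k => [set x | (f x <= k%:R%:E)%E]); split.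
- move=> k; rewrite (_ : mkset _ = f @^-1` `]-oo, k%:R%:E]).
    by rewrite -[X in measurable X]setTI; apply: mf => //; exact: emeasurable_itv.
  by apply/seteqP; split => x; rewrite /= in_itv.
- by move=> k l kl x /= /le_trans; apply; rewrite lee_fin ler_nat.
- apply/seteqP; split => // x _; exists (Num.bound (fine (f x))) => //=.
  by rewrite -[leLHS]fineK// lee_fin ltW// archi_boundP// fine_ge0.
move=> k A mA Ak; rewrite nuE// -integral_cst//.
by apply: ge0_le_integral => //; exact: measurable_funTS.
Qed.

Section thin.
Context (R : realType) (N : nat) d (S : measurableType d).

(** Collects what the covering argument uses of the law of X: on each E_k, X is bounded and slabs
    have probability O(eps / delta). *)
Definition thin_exhaustion (rho : set S -> \bar R) (X : S -> 'rV[R]_N)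
    (E : nat -> set S) :=
  [/\ forall k, measurable (E k), forall k l, (k <= l)%N -> E k `<=` E l,
    \bigcup_k E k = setT, forall k h, E k h -> cube k%:R (X h) &
    forall k, exists2 C : R, 0 <= C & forall (a : 'rV[R]_N) j (delta eps : R), 0 < delta ->
      delta <= `|a ord0 j| -> 0 <= eps ->
      (rho (E k `&` [set h | `|dotp a (X h)| <= eps]%R) <= (C * (eps / delta))%:E)%E].

Lemma thin_exhaustion_exists (rho : probability S R) (X : {mfun S >-> 'rV[R]_N}) :
  distribution rho X `<< lebesgue_rV N ->
  exists E, thin_exhaustion rho X E.
Proof.
move=> /density_truncation[E [mE ndE UE Erho]].
exists (fun k => X @^-1` (E k `&` cube k%:R)).
have mEc k : measurable (E k `&` cube k%:R).
  by apply: measurableI => //; exact: measurable_cube.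
split.
- by move=> k; rewrite -[X in measurable X]setTI; exact: measurable_funPT.
- move=> k l kl h [/(ndE _ _ kl) El ch]; split => // i.
  by rewrite (le_trans (ch i))// ler_nat.
- apply/seteqP; split => // h _.
  have [k _ Ek] : (\bigcup_k E k) (X h) by rewrite UE.
  exists (maxn k (Num.truncn `|X h|).+1) => //; split.
    by apply: ndE Ek; exact: leq_maxl.
  move=> i; rewrite (le_trans (rV_norm_coord _ _))//.
  rewrite (le_trans (ltW (truncnS_gt _)))// ler_nat leq_maxr//.
- by move=> k h [].
move=> k; exists (k%:R * ((2 * k%:R) ^+ N.-1 * 2)).
  by rewrite !mulr_ge0// exprn_ge0// mulr_ge0.
move=> a j delta eps d0 aj eps0.
have mA : measurable (E k `&` (cube k%:R `&` slab a 0 eps)).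
  by rewrite setIA; apply: measurableI => //; exact: measurable_slab.
have -> : X @^-1` (E k `&` cube k%:R) `&` [set h | `|dotp a (X h)| <= eps] =
    X @^-1` (E k `&` (cube k%:R `&` slab a 0 eps)).
  by apply/seteqP; split => h; rewrite /slab/= addr0 => -[]; [move=> []|move=> ? []].
apply: (le_trans (Erho k _ mA _)); first by move=> z [].
apply: (@le_trans _ _ (k%:R%:E * ((2 * k%:R) ^+ N.-1 * (2 * eps / delta))%:E)%E); last first.
  by rewrite -EFinM lee_fin !mulrA.
rewrite lee_wpmul2l// (le_trans _ (@lebesgue_slab _ _ k%:R delta eps 0 a j _ d0 eps0 aj))//.
apply: le_measure; rewrite ?inE//.
by apply: measurableI; [exact: measurable_cube|exact: measurable_slab].
Qed.

End thin.

Section finite_measure_bounds.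
Context d (T : measurableType d) (R : realType) (mu : {measure set T -> \bar R}).

Lemma measure_bigsetU_le (I : Type) (s : seq I) (A : I -> set T) :
  (forall i, measurable (A i)) ->
  measurable (\big[setU/set0]_(i <- s) A i) /\
  (mu (\big[setU/set0]_(i <- s) A i) <= \sum_(i <- s) mu (A i))%E.
Proof.
move=> mA; elim: s => [|i s [IH1 IH2]]; first by rewrite !big_nil measure0.
rewrite !big_cons; split; first exact: measurableU.
by rewrite (le_trans (measureU2 mu _ _))// leeD2l.
Qed.

(** The exceptional events are not known to be measurable; the covers for eps = 1 / (k + 1) enclose
    them in a measurable null set. *)
Lemma negligible_squeeze (A : set T) :
  (forall eps : R, 0 < eps -> exists B, [/\ measurable B, A `<=` B & (mu B <= eps%:E)%E]) ->
  mu.-negligible A.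
Proof.
move=> H; have e0 k : 0 < k.+1%:R^-1 :> R by rewrite invr_gt0.
pose B k := sval (cid (H _ (e0 k))).
have BP k : [/\ measurable (B k), A `<=` B k & (mu (B k) <= (k.+1%:R^-1)%:E)%E].
  by rewrite /B; case: cid.
exists (\bigcap_k B k); split.
- by apply: bigcap_measurable => // k; have [] := BP k.
- apply/eqP; rewrite eq_le measure_ge0 andbT; apply/lee_addgt0Pr => eps eps0.
  rewrite add0e.
  have [k _ /(_ k (leqnn k)) ke] := near_infty_natSinv_lt (PosNum eps0).
  have [mB _ Bk] := BP k.
  apply: (@le_trans _ _ (mu (B k))).
    apply: le_measure; rewrite ?inE//; last by move=> x; exact.
    by apply: bigcap_measurable => // l; have [] := BP l.
  by rewrite (le_trans Bk)// lee_fin ltW.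
- by move=> x Ax k _; have [_ AB _] := BP k; exact: AB.
Qed.

End finite_measure_bounds.

(** * Almost sure separation by random bilinear samples *)

Section dotp_theory.
Context (R : realType) (N : nat).
Implicit Types (a b x y : 'rV[R]_N) (D : 'M[R]_N).

Lemma dotpBl a b x : dotp (a - b) x = dotp a x - dotp b x.
Proof. by rewrite /dotp -sumrB; apply: eq_bigr => i _; rewrite !mxE mulrBl. Qed.

Lemma mulmx_dotp x D j : (x *m D) ord0 j = dotp (row j D^T) x.
Proof. by rewrite mxE; apply: eq_bigr => i _; rewrite !mxE mulrC. Qed.

Lemma dotp_le a x (c r : R) : (forall i, `|a ord0 i| <= c) -> (forall i, `|x ord0 i| <= r) ->
  `|dotp a x| <= N%:R * (c * r).
Proof.
move=> ac xr; rewrite (le_trans (ler_norm_sum _ _ _))//.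
rewrite mulr_natl -[X in _ *+ X]card_ord -sumr_const; apply: ler_sum => i _.
by rewrite normrM ler_pM.
Qed.

End dotp_theory.

Section almost_sure_separation.
Context (R : realType) (N : nat) dS (S : measurableType dS) (rho : probability S R).
Context (X : {mfun S >-> 'rV[R]_N}) (E : nat -> set S).
Hypothesis thinE : thin_exhaustion rho X E.

Let mE k : measurable (E k). Proof. by have [] := thinE. Qed.

Let mdotp (a : 'rV[R]_N) : measurable_fun setT (fun h => dotp a (X h) : R).
Proof. exact: (measurableT_comp (measurable_dotp a)). Qed.

Let mnorm_le d (T : measurableType d) (f : T -> R) c : measurable_fun setT f ->
  measurable [set x | `|f x| <= c].
Proof.
move=> mf; rewrite (_ : mkset _ = f @^-1` `[- c, c]).
  by rewrite -[X in measurable X]setTI; apply: mf => //; exact: measurable_itv.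
by apply/seteqP; split => x; rewrite /= in_itv/= -ler_norml.
Qed.

Let mnorm_ge d (T : measurableType d) (f : T -> R) c : measurable_fun setT f ->
  measurable [set x | c <= `|f x|].
Proof.
move=> mf; rewrite (_ : mkset _ = (fun x => `|f x|) @^-1` `[c, +oo[).
  rewrite -[X in measurable X]setTI.
  have mnf : measurable_fun setT (fun x => `|f x|) by exact: measurableT_comp.
  by apply: mnf => //; exact: measurable_itv.
by apply/seteqP; split => x; rewrite /= in_itv/= andbT.
Qed.

Definition bilinear (D : 'M[R]_N) (p : S * S) : R := dotp (X p.1 *m D) (X p.2).

(* The set where [bilinear D] is at most eps has measure of order
   eps * log (1 / eps). Splitting according to the size of the j-th entry of
   [X p.1 *m D], and asking this entry itself to be small where it is not
   bounded below, avoids the logarithm, cf. the two cases of [exceptional]. *)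
Definition small_values k (D : 'M[R]_N) j (eta eps : R) : set (S * S) :=
  ((E k `&` [set h | `|dotp (row j D^T) (X h)| <= eps]) `*` setT) `|`
  [set p | (E k `*` E k) p /\
    (eta <= `|dotp (row j D^T) (X p.1)| /\ `|bilinear D p| <= eps)].

Let mbilinear D : measurable_fun setT (bilinear D).
Proof.
apply: measurable_sum => j; apply: measurable_funM.
  rewrite (_ : (fun _ => _) = (fun h => dotp (row j D^T) (X h)) \o fst).
    exact: measurableT_comp.
  by apply/funext => p; rewrite mulmx_dotp.
have mc := measurableT_comp (measurable_coord j) (@measurable_funPT _ _ _ _ X).
exact: (measurableT_comp mc measurable_snd).
Qed.

Lemma measurable_small_values k D j eta eps : measurable (small_values k D j eta eps).
Proof.
apply: measurableU.
  by apply: measurableX => //; apply: measurableI => //; exact: mnorm_le.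
apply: measurableI; first exact: measurableX.
apply: measurableI; last exact: mnorm_le.
apply: (@mnorm_ge _ _ (fun p : S * S => dotp (row j D^T) (X p.1))).
exact: (measurableT_comp (mdotp _) measurable_fst).
Qed.

(** Both pieces are slab estimates: the first in p.1, for the j-th column of D, whose i-th entry is
    at least eta; the second in p.2 with p.1 fixed, for the vector [X p.1 *m D], whose j-th entry is
    at least eta. *)
Lemma small_values_le k : exists2 C : R, 0 <= C &
  forall (D : 'M[R]_N) i j (eta eps : R), 0 < eta ->
  eta <= `|D i j| -> 0 <= eps ->
  ((rho \x rho) (small_values k D j eta eps) <= (C * (eps / eta))%:E)%E.
Proof.
have [_ _ _ _ /(_ k)[C C0 CP]] := thinE.
exists (2 * C); first by rewrite mulr_ge0.
move=> D i j eta eps eta0 Dij eps0.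
have rho1 A : measurable A -> (rho A <= 1)%E by exact: probability_le1.
have Ce0 : (0 <= (C * (eps / eta))%:E)%E.
  by rewrite lee_fin mulr_ge0// divr_ge0// ltW.
have mA1 : measurable (E k `&` [set h | `|dotp (row j D^T) (X h)| <= eps]).
  by apply: measurableI => //; exact: mnorm_le.
have mA2 : measurable [set p : S * S | (E k `*` E k) p /\
    (eta <= `|dotp (row j D^T) (X p.1)| /\ `|bilinear D p| <= eps)].
  apply: measurableI; first exact: measurableX.
  apply: measurableI; last exact: mnorm_le.
  apply: (@mnorm_ge _ _ (fun p : S * S => dotp (row j D^T) (X p.1))).
  exact: (measurableT_comp (mdotp _) measurable_fst).
apply: (le_trans (measureU2 _ (measurableX mA1 measurableT) mA2)).
have -> : ((2 * C * (eps / eta))%:E = (C * (eps / eta))%:E + (C * (eps / eta))%:E)%E.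
  by rewrite -EFinD; congr EFin; lra.
apply: leeD.
  rewrite [leLHS](product_measure1E rho rho mA1 measurableT).
  rewrite [X in (_ * X)%E](probability_setT rho) mule1.
  by apply: (CP _ i) => //; rewrite !mxE.
pose B := [set h | eta <= `|dotp (row j D^T) (X h)|].
have mB : measurable B by exact: mnorm_ge.
have h1 : ((rho \x rho) [set p : S * S | (E k `*` E k) p /\
    (eta <= `|dotp (row j D^T) (X p.1)| /\ `|bilinear D p| <= eps)%R] <=
    (C * (eps / eta))%:E * rho B)%E.
  apply: product_measure_le_xsection => //.
    by move=> x y [_ []].
  move=> x xeta; apply: le_trans (CP (X x *m D) j eta eps eta0 _ eps0).
    apply: le_measure; rewrite ?inE//; first exact: measurable_xsection.
      by apply: measurableI => //; exact: mnorm_le.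
    by move=> y /xsectionP[[_ Ey] [_ bl]]; split.
  by rewrite mulmx_dotp.
apply: (le_trans h1).
by rewrite -[leRHS]mule1 lee_wpmul2l// rho1.
Qed.

Context (V : normedModType R) (d : nat) (K : set V) (beta : V -> 'M[R]_N) (L : R).
Hypotheses (Kd : box_dimension_le d K) (L0 : 0 <= L)
  (betaL : forall s t, K s -> K t -> forall i j,
    `|beta s i j - beta t i j| <= L * `|s - t|).
Context (n : nat) (hn : (2 * d + 1 <= n)%N).
Context dT (T : measurableType dT) (P : probability T R).
Variable FG : 'I_n -> {RV P >-> (S * S)%type}.
Hypothesis iidFG : iid_sample FG (rho \x rho)%E.

(* Up to shrinking theta and increasing k, every bad event is of this form: only
   finitely many entries have to be zero or bounded below. *)
Definition exceptional k (theta : R) i j : set T :=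
  [set w | exists s t, [/\ K s, K t, theta <= `|(beta s - beta t) i j| &
    forall l, let p := FG l w in let v := dotp (row j (beta s - beta t)^T) (X p.1) in
      [/\ E k p.1, E k p.2, bilinear (beta s - beta t) p = 0 & v = 0 \/ theta <= `|v|]]].

Lemma probability_all_samples (A : set (S * S)) (u : R) : measurable A ->
  ((rho \x rho) A <= u%:E)%E ->
  measurable (\bigcap_(l in [set l : 'I_n | l \in [set: 'I_n]%SET]) FG l @^-1` A) /\
  (P (\bigcap_(l in [set l : 'I_n | l \in [set: 'I_n]%SET]) FG l @^-1` A) <= (u ^+ n)%:E)%E.
Proof.
move=> mA Au; split.
  by apply: fin_bigcap_measurable => // l _; exact: measurable_funPTI.
have [distFG indFG] := iidFG.
rewrite (indFG [set: 'I_n]%SET (fun=> A))//.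
apply: (@le_trans _ _ (\prod_(l in [set: 'I_n]%SET) u%:E)%E).
  apply: (big_ind2 (fun x y => (0 <= x)%E /\ (x <= y)%E) _ _ _).2 => //.
  - by move=> x1 y1 x2 y2 [? ?] [? ?]; split; [exact: mule_ge0|exact: lee_pmul].
  - move=> l _; split; first exact: measure_ge0.
    by rewrite -[leLHS]/(distribution P (FG l) A) distFG.
by rewrite prodEFin prodr_const cardsT card_ord.
Qed.

(** s and t are replaced by representatives of their cells. Since X is bounded by k on E_k, an exact
    zero becomes a value of order 1 / p, for one of O(p^(2 d)) matrices. *)
Lemma exceptional_approx k theta i j : 0 < theta -> exists2 Q : R, 0 <= Q &
  exists C : nat, forall p : nat, Q / p.+1%:R <= theta / 2 ->
  exists (I : finType) (D : I -> 'M[R]_N), (#|I| <= C * p.+1 ^ (2 * d))%N /\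
    forall w, exceptional k theta i j w -> exists2 q, theta / 2 <= `|D q i j| &
      forall l, small_values k (D q) j (theta / 2) (Q / p.+1%:R) (FG l w).
Proof.
move=> theta0; have [C KC] := Kd; have [_ _ _ Ecube _] := thinE.
pose kappa p : R := 2 * L * (C%:R / p.+1%:R).
(* Over p + 1, the three summands bound the changes of the j-th entry of [X p.1 *m D], of the
   bilinear value, and of the entries of D. *)
pose Q := (N%:R * k%:R + N%:R * N%:R * k%:R * k%:R + 1) * (2 * L * C%:R).
have Q0 : 0 <= Q by rewrite !mulr_ge0// !addr_ge0// !mulr_ge0.
exists Q => //; exists (C ^ 2)%N => // p Qp.
have [I [c [IC cK]]] := KC p.
(* For a cell that misses K this is a default value; in what follows only cells of points of K are
   selected. *)
pose rep (x : I) := get [set s | K s /\ c s = x].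
have repP s : K s -> K (rep (c s)) /\ `|s - rep (c s)| <= C%:R / p.+1%:R.
  move=> Ks; have [Kr cr] := @getI _ [set s' | K s' /\ c s' = c s] s (conj Ks erefl).
  by split => //; exact: cK.
exists (I * I)%type, (fun q => beta (rep q.1) - beta (rep q.2)); split.
  by rewrite card_prod (leq_trans (leq_mul IC IC))// mulnn expnMn -expnM (mulnC d).
move=> w [s [t [Ks Kt Dst wst]]].
have [Ks' ss'] := repP s Ks; have [Kt' tt'] := repP t Kt.
pose D := beta s - beta t; pose D' := beta (rep (c s)) - beta (rep (c t)).
rewrite -/D in Dst wst.
have kappa0 : 0 <= kappa p by rewrite !mulr_ge0.
have DD a b : `|(D - D') a b| <= kappa p.
  have -> : (D - D') a b =
      (beta s a b - beta (rep (c s)) a b) - (beta t a b - beta (rep (c t)) a b).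
    by rewrite /D /D' !mxE; lra.
  rewrite (le_trans (ler_normB _ _))//.
  have := betaL Ks Ks' a b; have := betaL Kt Kt' a b.
  have := ler_wpM2l L0 ss'; have := ler_wpM2l L0 tt'.
  rewrite /kappa; move: (C%:R / p.+1%:R) => z.
  move=> h1 h2 h3 h4; have -> : 2 * L * z = L * z + L * z by rewrite -mulrA mulr_natl mulr2n.
  exact: lerD (le_trans h4 h2) (le_trans h3 h1).
suff [HD Hl] : theta / 2 <= `|D' i j| /\
    forall l, small_values k D' j (theta / 2) (Q / p.+1%:R) (FG l w).
  by exists (c s, c t).
have QE : Q / p.+1%:R = (N%:R * k%:R + N%:R * N%:R * k%:R * k%:R + 1) * kappa p.
  by rewrite /Q /kappa !mulrA.
move: QE Qp; set e := Q / p.+1%:R => QE Qp.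
move: (kappa p) kappa0 DD QE => kap kap0 DD QE.
have a0 : 0 <= N%:R * k%:R * kap by rewrite !mulr_ge0.
have b0 : 0 <= N%:R * N%:R * k%:R * k%:R * kap by rewrite !mulr_ge0.
split.
  have := DD i j; have := lerB_dist (D i j) (D' i j).
  rewrite (_ : (D - D') i j = D i j - D' i j); last by rewrite !mxE.
  lra.
move=> l; have [E1 E2 bl0 v0] := wst l.
have c1 := Ecube _ _ E1; have c2 := Ecube _ _ E2.
have vv b : `|(X (FG l w).1 *m (D - D')) ord0 b| <= N%:R * (kap * k%:R).
  by rewrite mulmx_dotp; apply: dotp_le => // a; rewrite !mxE; have := DD a b; rewrite !mxE.
have vj : `|dotp (row j D^T) (X (FG l w).1) - dotp (row j D'^T) (X (FG l w).1)| <=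
    N%:R * (kap * k%:R).
  by rewrite -dotpBl -linearB -linearB/= -mulmx_dotp.
have bl : `|bilinear D' (FG l w)| <= e.
  have := dotp_le vv c2; rewrite mulmxBr dotpBl.
  rewrite -/(bilinear D (FG l w)) -/(bilinear D' (FG l w)).
  rewrite bl0 sub0r normrN QE; lra.
have dle := lerB_dist (dotp (row j D^T) (X (FG l w).1)) (dotp (row j D'^T) (X (FG l w).1)).
(* The two alternatives of [exceptional] lead to the two pieces of [small_values]. *)
case: v0 => [v0|v0].
  by left; split => //; split => //=; rewrite v0 sub0r normrN in vj; lra.
by right; split => //; split => //=; lra.
Qed.

(** Union bound: O(p^(2 d)) matrices, each with probability O(p^(-n)) by independence, give O(1 / p)
    in total. *)
Lemma exceptional_negligible k theta i j : 0 < theta ->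
  P.-negligible (exceptional k theta i j).
Proof.
move=> theta0; apply: negligible_squeeze => eps eps0.
have [Q Q0 [C H]] := exceptional_approx k i j theta0.
have [B B0 BP] := small_values_le k.
have t20 : 0 < theta / 2 by rewrite divr_gt0.
pose Z := C%:R * (B * (Q / (theta / 2))) ^+ n.
have Z0 : 0 <= Z by rewrite mulr_ge0// exprn_ge0// mulr_ge0// divr_ge0// ltW.
have [p [pQ pZ]] : exists p : nat, Q / p.+1%:R <= theta / 2 /\ Z / p.+1%:R <= eps.
  exists (Num.truncn (Q / (theta / 2)) + Num.truncn (Z / eps))%N; split.
    rewrite ler_pdivrMr// mulrC -ler_pdivrMr// (le_trans (ltW (truncnS_gt _)))//.
    by rewrite ler_nat ltnS leq_addr.
  rewrite ler_pdivrMr// mulrC -ler_pdivrMr// (le_trans (ltW (truncnS_gt _)))//.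
  by rewrite ler_nat ltnS leq_addl.
have [I [D [IC HD]]] := H p pQ.
(* [small_values_le] needs an entry bounded below, so the other matrices get the empty event. *)
pose A q := if theta / 2 <= `|D q i j|
  then small_values k (D q) j (theta / 2) (Q / p.+1%:R) else set0.
pose u := B * (Q / p.+1%:R / (theta / 2)).
have u0 : 0 <= u by rewrite mulr_ge0// !divr_ge0// ltW.
have mA q : measurable (A q) by rewrite /A; case: ifP => // _; exact: measurable_small_values.
have Au q : ((rho \x rho) (A q) <= u%:E)%E.
  rewrite /A; case: ifPn => Dq; last by rewrite measure0 lee_fin.
  by apply: (BP _ i) => //; rewrite divr_ge0.
have PA q := probability_all_samples (mA q) (Au q).
pose F q := \bigcap_(l in [set l : 'I_n | l \in [set: 'I_n]%SET]) FG l @^-1` A q.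
have [mF PF] := measure_bigsetU_le P (index_enum I) (fun q => (PA q).1).
exists (\big[setU/set0]_(q <- index_enum I) F q); split => //.
  move=> w /HD[q Dq qw]; rewrite -bigcup_seq; exists q; first by rewrite /= mem_index_enum.
  by move=> l _; rewrite /= /A Dq; exact: qw.
apply: (le_trans PF); apply: (@le_trans _ _ (\sum_(q <- index_enum I) (u ^+ n)%:E)%E).
  by apply: lee_sum => q _; exact: (PA q).2.
rewrite sumEFin lee_fin big_const_seq count_predT iter_addr_0 -[index_enum I]enumT -cardT.
apply: le_trans pZ.
have P0 : 0 < p.+1%:R :> R by [].
have uE : u ^+ n = (B * (Q / (theta / 2))) ^+ n / p.+1%:R ^+ n.
  by rewrite -expr_div_n /u mulrAC !mulrA.
rewrite uE -[leLHS]mulr_natr.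
have IC' : #|I|%:R <= C%:R * p.+1%:R ^+ (2 * d) :> R.
  by rewrite -natrX -natrM ler_nat.
have BQ0 : 0 <= (B * (Q / (theta / 2))) ^+ n.
  by rewrite exprn_ge0// mulr_ge0// divr_ge0// ltW.
apply: (@le_trans _ _
  ((B * (Q / (theta / 2))) ^+ n / p.+1%:R ^+ n * (C%:R * p.+1%:R ^+ (2 * d)))).
  by rewrite ler_wpM2l// divr_ge0// exprn_ge0.
have -> : (B * (Q / (theta / 2))) ^+ n / p.+1%:R ^+ n * (C%:R * p.+1%:R ^+ (2 * d)) =
    Z * (p.+1%:R ^+ (2 * d) / p.+1%:R ^+ n).
  by rewrite /Z mulrCA -!mulrA; congr (_ * (_ * _)); rewrite mulrC.
(* Here n >= 2 d + 1 enters: one power of p + 1 is gained over the number of pairs of cells. *)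
rewrite ler_wpM2l// ler_pdivrMr ?exprn_gt0// ler_pdivlMl// -exprS.
by apply: ler_weXn2l; rewrite ?ler1n// -addn1.
Qed.

(** The bad event lies in the countable union of the exceptional events with theta = 1 / (k + 1):
    for a given outcome, the finitely many conditions hold for all large k. *)
Lemma almost_surely_separated : {ae P, forall w, forall s t, K s -> K t ->
  (forall l, bilinear (beta s) (FG l w) = bilinear (beta t) (FG l w)) -> beta s = beta t}.
Proof.
pose F m := if unpickle m is Some (k, i, j) then exceptional k k.+1%:R^-1 i j else set0.
have nF m : P.-negligible (F m).
  rewrite /F; case: unpickle => [[[k i] j]|]; last exact: negligible_set0.
  by apply: exceptional_negligible; rewrite invr_gt0.
apply: negligibleS (negligible_bigcup nF) => w /existsNP[s] /existsNP[t].
move=> /not_implyP[Ks] /not_implyP[Kt] /not_implyP[st bst].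
have [i [j Dij]] : exists i j, (beta s - beta t) i j != 0.
  apply: contrapT => H; apply: bst; apply/eqP; rewrite -subr_eq0; apply/eqP/matrixP => i j.
  by rewrite [RHS]mxE; apply: contrapT => /eqP Dij; apply: H; exists i, j.
have [_ ndE UE _ _] := thinE.
have nearE h : \forall k \near \oo, E k h.
  have [k _ Ek] : (\bigcup_k E k) h by rewrite UE.
  by exists k => // l /= kl; exact: ndE Ek.
have near_le (x : R) : x != 0 -> \forall k \near \oo, k.+1%:R^-1 <= `|x|.
  rewrite -normr_gt0 => x0.
  by apply: filterS (near_infty_natSinv_lt (PosNum x0)) => k /ltW.
pose v l := dotp (row j (beta s - beta t)^T) (X (FG l w).1).
have kP l : \forall k \near \oo, [/\ E k (FG l w).1, E k (FG l w).2 &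
    v l = 0 \/ k.+1%:R^-1 <= `|v l|].
  have nv : \forall k \near \oo, v l = 0 \/ k.+1%:R^-1 <= `|v l|.
    have [v0|v0] := eqVneq (v l) 0; first by near=> k; left.
    by apply: filterS (near_le _ v0) => k; right.
  near=> k; split.
  - by near: k; exact: nearE.
  - by near: k; exact: nearE.
  - by near: k.
have kA : \forall k \near \oo, forall l, [/\ E k (FG l w).1, E k (FG l w).2 &
    v l = 0 \/ k.+1%:R^-1 <= `|v l|].
  exact: filter_forall.
have [k [Dk kl]] := filter_ex (filterI (near_le _ Dij) kA).
exists (pickle (k, i, j)) => //; rewrite /F pickleK.
exists s, t; split => // l; have [E1 E2 vl] := kl l; split => //.
by rewrite /bilinear mulmxBr dotpBl -/(bilinear _ _) st subrr.
Unshelve. all: by end_near. Qed.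

End almost_sure_separation.

(** * Gradient fields, coordinates on H_N and conclusion *)

(** A gradient is chosen for every sigma and f. The solution for tau, g has trace [Lam tau g] and is
    an admissible test function in the equation for sigma, f. *)
Lemma NtD_gradient_fields (R : realType) (m : nat) (Omega : set 'rV[R]_m)
    (Lam : Linfty (volume Omega) ->
      compact_op (L2mean0 (surface Omega)) (L2mean0 (surface Omega))) :
  is_NtD Lam ->
  exists Gr : Linfty (volume Omega) -> L2mean0 (surface Omega) -> 'I_m -> L2 (volume Omega),
    forall sigma tau f g, elliptic sigma -> elliptic tau ->
      form sigma (Gr sigma f) (Gr tau g) = inner f (Lam tau g).
Proof.
move=> LamP.
have sol (p : Linfty (volume Omega) * L2mean0 (surface Omega)) :
    exists G : 'I_m -> L2 (volume Omega), elliptic p.1 -> exists u,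
      [/\ weak_gradient u G, has_trace u (L2val (Lam p.1 p.2)) &
       forall v H t, weak_gradient v H -> has_trace v t ->
       form p.1 G H = L2_inner (L2val p.2) t].
  have [ep|nep] := pselect (elliptic p.1); last by exists (fun=> 0).
  have [u [G uG GP] tu] := LamP _ ep p.2.
  by exists G => _; exists u.
have [Gr GrP] := choice sol.
exists (fun sigma f => Gr (sigma, f)) => sigma tau f g es et.
have [_ [_ _ solP]] := GrP (sigma, f) es.
have [v [vG tv _]] := GrP (tau, g) et.
exact: solP vG tv.
Qed.

Section coordinates.
Context dS (T : measurableType dS) (R : realType) (nu : {measure set T -> \bar R}).
Variables (e : nat -> L2mean0 nu) (N : nat).
Hypothesis he : orthonormal_basis e.

Definition span_coord (h : fin_span e N) : 'rV[R]_N :=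
  \row_j inner (fin_span_val h) (e j).

Lemma inner_lincomb (x : 'rV[R]_N) (f : L2mean0 nu) :
  inner (lincomb e x) f = \sum_j x ord0 j * inner (e j) f.
Proof. by rewrite inner_suml; apply: eq_bigr => j _; rewrite innerZl. Qed.

Lemma to_fin_spanK : cancel (@to_fin_span R (L2mean0 nu) e N) span_coord.
Proof.
move=> x; apply/rowP => j; rewrite mxE.
rewrite -[fin_span_val _]/(lincomb e x) inner_lincomb (bigD1 j)//= big1.
  by rewrite addr0 /inner he.1 eqxx mulr1.
by move=> i ij; rewrite /inner he.1 -val_eqE/= in ij *; rewrite (negbTE ij) mulr0.
Qed.

Lemma span_coordK (h : fin_span e N) : lincomb e (span_coord h) = fin_span_val h.
Proof.
case: h => f fP; have /set_mem[x _ xf] := fP.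
have -> : exist _ f fP = to_fin_span e x.
  by apply: val_inj; rewrite /= xf.
by rewrite to_fin_spanK.
Qed.

Lemma measurable_span_coord : measurable_fun setT span_coord.
Proof.
move=> _ A mA; rewrite setTI.
rewrite /measurable/= /image_set_system/= setTI.
rewrite -comp_preimage (_ : span_coord \o to_fin_span e (N := N) = id).
  by rewrite preimage_id.
by apply/funext => x; exact: to_fin_spanK.
Qed.

Definition span_coord_mfun : {mfun fin_span e N >-> 'rV[R]_N} :=
  HB.pack span_coord (isMeasurableFun.Build _ _ _ _ span_coord measurable_span_coord).

(** Lebesgue measure on the span is the image of that on R^N under [to_fin_span], whose inverse is
    [span_coord]; null sets correspond. *)
Lemma distribution_span_coord (rho : probability (fin_span e N) R) :
  rho `<< @lebesgue_fin_span R (L2mean0 nu) e N ->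
  distribution rho span_coord_mfun `<< lebesgue_rV N.
Proof.
move=> ac; apply/null_content_dominatesP => A mA A0.
have mXA : measurable (span_coord @^-1` A).
  by rewrite -[X in measurable X]setTI; exact: measurable_span_coord.
apply: (ac (span_coord @^-1` A)) => // B mB BA.
have mB' : measurable (to_fin_span e (N := N) @^-1` B).
  by move: mB; rewrite /measurable/= /image_set_system/= setTI.
apply: (subset_measure0 mB' mA _ A0) => x Bx.
by rewrite -(to_fin_spanK x); exact: BA.
Qed.

End coordinates.

Theorem theorem3p2 (R : realType) (m : nat) (hm : (2 <= m)%N)
    (Omega : set 'rV[R]_m) (hOmega : bounded_lipschitz_domain Omega)
    (e : nat -> L2mean0 (surface Omega)) (he : orthonormal_basis e)
    (d : nat) (M : set (Linfty (volume Omega)))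
    (hM : analytic_manifold d M) (hMsc : @second_countable M)
    (K : set (Linfty (volume Omega))) (hK : compact K)
    (hKM : K `<=` @Linfty_pos R m Omega `&` M)
    (hinj : {in K &, injective (@NtD R m Omega)})
    (hdiff : forall sigma, K sigma ->
      {in tangent_space d M sigma &, injective ('d (@NtD R m Omega) sigma)}) :
  exists N0 : nat, forall N : nat, (N0 <= N)%N ->
  forall rho : probability (fin_span e N) R,
    rho `<< @lebesgue_fin_span R (L2mean0 (surface Omega)) e N ->
  forall n : nat, (2 * d + 1 <= n)%N ->
  forall (disp : measure_display) (T : measurableType disp)
    (P : probability T R) (FG : 'I_n -> {RV P >-> (fin_span e N * fin_span e N)%type}),
    iid_sample FG (rho \x rho)%E ->
  {ae P, forall w : T, forall sigma1 sigma2, K sigma1 -> K sigma2 ->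
    (forall i : 'I_n,
      L2_inner (NtD sigma1 (fin_span_val (FG i w).1)) (fin_span_val (FG i w).2) =
      L2_inner (NtD sigma2 (fin_span_val (FG i w).1)) (fin_span_val (FG i w).2)) ->
    sigma1 = sigma2}.
Proof.
have [[Lam0 LamP0]|noLam] := pselect (exists Lam, @is_NtD R m Omega Lam); last first.
  (* [NtD] is then the junk value 0, and K has at most one element. *)
  have NtD0 : @NtD R m Omega = (fun=> 0).
    by apply: xgetPN => Lam LamP; apply: noLam; exists Lam.
  exists 0%N => N _ rho _ n _ disp T P FG _; apply: nearW => w s1 s2 K1 K2 _.
  by apply: hinj; rewrite ?inE// NtD0.
have LamP : is_NtD (@NtD R m Omega) by apply: xgetPex; exists Lam0.
have [Gr GrE] := NtD_gradient_fields LamP.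
have [N0 sepN0] := separated_uniform GrE he hM hK hKM hinj hdiff.
exists N0 => N N0N rho ac n hn disp T P FG iid.
set Lam := @NtD R m Omega in GrE sepN0 LamP *.
pose X := span_coord_mfun N he.
have [E thinE] := thin_exhaustion_exists (distribution_span_coord he ac).
have Kd : box_dimension_le d K.
  by apply: (box_dimension_le_manifold hM hK) => s /hKM[].
have Ke : K `<=` @elliptic _ _ R (volume Omega) by move=> s /hKM[].
(* Row i belongs to the argument e_i of the operator, so that x *m beta paired with y is the
   measurement for the coordinates x of f and y of g. *)
pose beta s : 'M[R]_N := \matrix_(i, j) inner (e j) (Lam s (e i)).
have bilinearE s p :
    bilinear X (beta s) p = inner (Lam s (fin_span_val p.1)) (fin_span_val p.2).
  rewrite -(span_coordK he p.1) -(span_coordK he p.2) innerC inner_lincomb.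
  apply: eq_bigr => j _; rewrite mulrC; congr (_ * _).
  rewrite mxE compact_op_sum innerC inner_suml; apply: eq_bigr => i _.
  by rewrite compact_opZ innerZl innerC [beta _ _ _]mxE.
have [L L0 betaL] : exists2 L, 0 <= L & forall s t, K s -> K t -> forall i j,
    `|beta s i j - beta t i j| <= L * `|s - t|.
  have lip (ij : 'I_N * 'I_N) := inner_NtD_lipschitz GrE (e ij.2) (e ij.1) hK Ke.
  (* A Lipschitz constant is chosen for each entry; their sum serves for all entries. *)
  have [L LP] := choice (fun ij =>
    let: ex_intro2 l l0 lP := lip ij in ex_intro _ l (conj l0 lP)).
  exists (\sum_ij L ij); first by apply: sumr_ge0 => ij _; exact: (LP ij).1.
  move=> s t Ks Kt i j; rewrite !mxE (le_trans ((LP (i, j)).2 s t Ks Kt))//.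
  rewrite ler_wpM2r// (bigD1 (i, j))//= lerDl.
  by apply: sumr_ge0 => ij _; exact: (LP ij).1.
have := almost_surely_separated thinE Kd L0 betaL hn iid.
apply: filterS => w sepw s1 s2 K1 K2 eqw.
have beta12 : beta s1 = beta s2 by apply: sepw => // l; rewrite !bilinearE; exact: eqw.
apply: contrapT => s12; have [i [j [iN jN]]] := sepN0 _ _ K1 K2 s12; apply.
(* The coefficient with indices i, j in [separated] is the entry (j, i) of beta. *)
have := congr1 (fun B : 'M[R]_N =>
  B (Ordinal (leq_trans jN N0N)) (Ordinal (leq_trans iN N0N))) beta12.
by rewrite !mxE.
Qed.
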